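(* Let $m\ge1$ be an integer, $A>C>0$ real, $r=\sqrt{C/(A-C)}$, $p\in(0,1)$, and $$h=\sqrt{\frac{1-p^2}{1+r^2}},\qquad q=rh,\qquad D=\frac{\sqrt{AC}}{p}.$$ Then for the metric $$g_P=g_{A,C}+\sigma\otimes\sigma+p(\beta_1\otimes\sigma+\sigma\otimes\beta_1)+q(\beta_3\otimes\sigma+\sigma\otimes\beta_3)$$ on $S^{4m-1}\times S^1_i$ and the foliation generated by $T=u_1$, the mixed-curvature operator $R_T$ is positive and parallel ($\nabla^\perp_TR_T=0$), with spectrum $\{AC/4,AC\}$ at every point; $AC$ is simple and $AC/4$ has multiplicity $4m-2$.
   Context: Notation. Let $g_0$ be the round metric of curvature $1$ on the unit sphere $S^{4m-1}\subset\mathbb H^m$, with $\xi_1(x)=xi$, $\xi_2(x)=xj$, $\xi_3(x)=xk$ and $\eta_\alpha=g_0(\xi_\alpha,\cdot)$. Put $L=2/\sqrt{AC}$, $M=2/A$, $g_{A,C}=L^2g_0+(M^2-L^2)\eta_2\otimes\eta_2$. The fields $u_1=\frac{\sqrt{AC}}2\xi_1$, $u_2=\frac A2\xi_2$, $u_3=\frac{\sqrt{AC}}2\xi_3$ are $g_{A,C}$-orthonormal and satisfy $[u_1,u_2]=Au_3$, $[u_2,u_3]=Au_1$, $[u_3,u_1]=Cu_2$; put $\beta_\alpha=g_{A,C}(u_\alpha,\cdot)$. Identify $S^3$ with the group $Sp(1)$ of unit quaternions, with the bi-invariant metric $g_{S^3}$ for which the left-invariant frame $v_1,v_2,v_3$,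 whose values at the identity are positive multiples of $i,j,k$ respectively, is orthonormal and satisfies $[v_1,v_2]=Dv_3$, $[v_2,v_3]=Dv_1$, $[v_3,v_1]=Dv_2$; put $\sigma_1=g_{S^3}(v_1,\cdot)$. Let $S^1_i=\{a+bi:a^2+b^2=1\}\subset Sp(1)=S^3$ and $\sigma=\sigma_1|_{S^1_i}$, the unit-length one-form dual to $v_1|_{S^1_i}$. Fields, forms and metrics on the factors are pulled back to the product without change of notation. The foliation generated by the $g_P$-unit field $T=u_1$ is totally geodesic ($\nabla_TT=0$). The mixed-curvature operator is $R_T:T^\perp\to T^\perp$, $R_T(U)=R(U,T)T$, where $R(X,Y)Z=\nabla_X\nabla_YZ-\nabla_Y\nabla_XZ-\nabla_{[X,Y]}Z$ for the Levi-Civita connection of $g_P$. The normal derivative is $(\nabla_T^\perp R_T)U=\nabla_T^\perp(R_TU)-R_T(\nabla_T^\perp U)$, where $\nabla_T^\perp U$ is the component of $\nabla_TU$ orthogonal to $T$. *)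

(* Defs.v *)
From HB Require Import structures.
From mathcomp Require Export all_boot all_order all_algebra.
From mathcomp Require Export all_classical all_reals all_analysis.
From mathcomp Require Import ring lra.
Set Implicit Arguments.
Unset Strict Implicit.
Unset Printing Implicit Defensive.
Export Order.TTheory GRing.Theory Num.Theory.
Export numFieldNormedType.Exports.
#[global] Open Scope classical_set_scope.
#[global] Open Scope ring_scope.

(** * Submanifolds of a normed space

  A compact embedded submanifold is given by its underlying set [M] and its
  tangent spaces [TM y].  By compactness every smooth vector field (or
  function) on [M] is the restriction of a smooth map on the whole ambient
  space, so fields are represented by such maps and all identities are only
  required at the points of [M].  Derivatives at a point of [M] in a tangent
  direction do not depend on the chosen extension. *)

(* On a finite-dimensional V this is the usual class C^k. *)
Fixpoint Ck (R : realType) (V W : normedModType R) (k : nat) (f : V -> W)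
    : Prop :=
  match k with
  | 0%N => continuous f
  | k'.+1 => (forall x, differentiable f x) /\
             (forall v, Ck k' (fun x => 'D_v f x))
  end.

Definition smooth (R : realType) (V W : normedModType R) (f : V -> W) : Prop :=
  forall k, Ck k f.

Definition lie_bracket (R : realType) (V : normedModType R) (X Y : V -> V)
    : V -> V :=
  fun y => 'D_(X y) Y y - 'D_(Y y) X y.

Section Submanifold.
Context {R : realType} {V : normedModType R}.
Variables (M : set V) (TM : V -> set V).

Definition tangent_field (X : V -> V) : Prop :=
  smooth X /\ forall y, M y -> TM y (X y).

Record riemannian_metric (g : V -> V -> V -> R) : Prop := RiemannianMetric {
  metric_linear : forall y, M y -> forall (a : R) v w u,
    TM y v -> TM y w -> TM y u ->
    g y (a *: v + w) u = a * g y v u + g y w u;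
  metric_sym : forall y, M y -> forall v w,
    TM y v -> TM y w -> g y v w = g y w v;
  metric_pos : forall y, M y -> forall v,
    TM y v -> v != 0 -> 0 < g y v v;
  metric_smooth : forall X Y, tangent_field X -> tangent_field Y ->
    smooth (fun y => g y (X y) (Y y) : R^o)
}.

Record affine_connection (nabla : (V -> V) -> (V -> V) -> V -> V) : Prop :=
  AffineConnection {
  nabla_tangent : forall X Y, tangent_field X -> tangent_field Y ->
    tangent_field (nabla X Y);
  nablaDl : forall X X' Y, tangent_field X -> tangent_field X' ->
    tangent_field Y -> forall y, M y ->
    nabla (fun z => X z + X' z) Y y = nabla X Y y + nabla X' Y y;
  nablaZl : forall (f : V -> R^o) X Y, smooth f -> tangent_field X ->
    tangent_field Y -> forall y, M y ->
    nabla (fun z => f z *: X z) Y y = f y *: nabla X Y y;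
  nablaDr : forall X Y Y', tangent_field X -> tangent_field Y ->
    tangent_field Y' -> forall y, M y ->
    nabla X (fun z => Y z + Y' z) y = nabla X Y y + nabla X Y' y;
  nablaZr : forall (f : V -> R^o) X Y, smooth f -> tangent_field X ->
    tangent_field Y -> forall y, M y ->
    nabla X (fun z => f z *: Y z) y =
      'D_(X y) f y *: Y y + f y *: nabla X Y y
}.

Record levi_civita (g : V -> V -> V -> R)
    (nabla : (V -> V) -> (V -> V) -> V -> V) : Prop := LeviCivita {
  levi_civita_connection : affine_connection nabla;
  torsion_free : forall X Y, tangent_field X -> tangent_field Y ->
    forall y, M y -> nabla X Y y - nabla Y X y = lie_bracket X Y y;
  metric_compatible : forall X Y Z, tangent_field X -> tangent_field Y ->
    tangent_field Z -> forall y, M y ->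
    'D_(X y) (fun z => g z (Y z) (Z z) : R^o) y =
      g y (nabla X Y y) (Z y) + g y (Y y) (nabla X Z y)
}.

Variables (g : V -> V -> V -> R) (nabla : (V -> V) -> (V -> V) -> V -> V).

Definition curvature (X Y Z : V -> V) : V -> V := fun y =>
  nabla X (nabla Y Z) y - nabla Y (nabla X Z) y - nabla (lie_bracket X Y) Z y.

Variable T : V -> V.

Definition normal_space (y : V) : set V :=
  [set w | TM y w /\ g y w (T y) = 0].

Definition normal_field (U : V -> V) : Prop :=
  smooth U /\ forall y, M y -> normal_space y (U y).

Definition mixed_curvature (U : V -> V) : V -> V := curvature U T T.

(* The projection [X - g(X,T) T] onto the orthogonal complement of [T] uses
   that [T] is a unit field. *)
Definition normal_nabla (U : V -> V) : V -> V := fun y =>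
  nabla T U y - g y (nabla T U y) (T y) *: T y.

Definition normal_derivative_mixed_curvature (U : V -> V) : V -> V := fun y =>
  normal_nabla (mixed_curvature U) y - mixed_curvature (normal_nabla U) y.

(* [f] is the value at [y] of the operator [R_T]; only its restriction to
   [normal_space y] is meaningful, and it is unique there. *)
Definition mixed_curvature_at (y : V) (f : V -> V) : Prop :=
  (forall U, normal_field U -> mixed_curvature U y = f (U y)) /\
  (forall w, normal_space y w -> normal_space y (f w)).

Definition positive_operator_at (y : V) (f : V -> V) : Prop :=
  (forall v w, normal_space y v -> normal_space y w ->
     g y (f v) w = g y v (f w)) /\
  (forall w, normal_space y w -> w != 0 -> 0 < g y (f w) w).

Definition eigenspace_at (y : V) (f : V -> V) (a : R) : set V :=
  [set w | normal_space y w /\ f w = a *: w].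

Definition spectrum_at (y : V) (f : V -> V) : set R :=
  [set a | exists2 w, eigenspace_at y f a w & w != 0].

End Submanifold.

Definition has_dim (K : fieldType) (vT : vectType K) (S : set vT) (d : nat)
    : Prop :=
  exists2 U : {vspace vT}, (forall w, S w <-> w \in U) & \dim U = d.

(** * Quaternions

  A vector of H^m is an m x 4 matrix whose rows contain the coordinates of its
  components in the basis 1, i, j, k. *)

Notation co0 := (@Ordinal 4 0 isT).
Notation co1 := (@Ordinal 4 1 isT).
Notation co2 := (@Ordinal 4 2 isT).
Notation co3 := (@Ordinal 4 3 isT).

Section Quaternions.
Context {R : realType}.

Definition qmul m (x : 'M[R]_(m, 4)) (q : 'rV[R]_4) : 'M[R]_(m, 4) :=
  \matrix_(s, t)
    [:: x s co0 * q 0 co0 - x s co1 * q 0 co1 - x s co2 * q 0 co2 - x s co3 * q 0 co3;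
        x s co0 * q 0 co1 + x s co1 * q 0 co0 + x s co2 * q 0 co3 - x s co3 * q 0 co2;
        x s co0 * q 0 co2 - x s co1 * q 0 co3 + x s co2 * q 0 co0 + x s co3 * q 0 co1;
        x s co0 * q 0 co3 + x s co1 * q 0 co2 - x s co2 * q 0 co1 + x s co3 * q 0 co0]`_t.

Definition q1 : 'rV[R]_4 := delta_mx 0 co0.
Definition qi : 'rV[R]_4 := delta_mx 0 co1.
Definition qj : 'rV[R]_4 := delta_mx 0 co2.
Definition qk : 'rV[R]_4 := delta_mx 0 co3.

Definition dot m (x y : 'M[R]_(m, 4)) : R := \sum_s \sum_t x s t * y s t.

End Quaternions.

(** * The metric on the sphere *)

Section Sphere.
Context {R : realType} {m : nat}.
Implicit Types x v w : 'M[R]_(m, 4).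

Definition xi1 x := qmul x qi.
Definition xi2 x := qmul x qj.
Definition xi3 x := qmul x qk.

Definition eta2 x v : R := dot (xi2 x) v.

Definition gAC (A C : R) x v w : R :=
  let L := 2 / Num.sqrt (A * C) in
  let M := 2 / A in
  L ^+ 2 * dot v w + (M ^+ 2 - L ^+ 2) * (eta2 x v * eta2 x w).

Definition u1 (A C : R) x := (Num.sqrt (A * C) / 2) *: xi1 x.
Definition u3 (A C : R) x := (Num.sqrt (A * C) / 2) *: xi3 x.

Definition beta1 (A C : R) x v : R := gAC A C x (u1 A C x) v.
Definition beta3 (A C : R) x v : R := gAC A C x (u3 A C x) v.

End Sphere.

(** * The group Sp(1)

  The left-invariant fields [z |-> c z i], [c z j], [c z k] satisfy
  [[c z i, c z j] = 2 c^2 z k], which forces [c = D / 2]; see [Sp1_frame]. *)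

Section Sp1.
Context {R : realType}.
Implicit Types z v w : 'rV[R]_4.

Definition v1 (D : R) z := (D / 2) *: qmul z qi.
Definition v2 (D : R) z := (D / 2) *: qmul z qj.
Definition v3 (D : R) z := (D / 2) *: qmul z qk.

Definition gS3 (D : R) z v w : R := (2 / D) ^+ 2 * dot v w.

Definition sigma1 (D : R) z v : R := gS3 D z (v1 D z) v.

Lemma qmulE0 m (x : 'M[R]_(m, 4)) (q : 'rV[R]_4) s : qmul x q s co0 =
  x s co0 * q 0 co0 - x s co1 * q 0 co1 - x s co2 * q 0 co2 - x s co3 * q 0 co3.
Proof. by rewrite mxE. Qed.

Lemma qmulE1 m (x : 'M[R]_(m, 4)) (q : 'rV[R]_4) s : qmul x q s co1 =
  x s co0 * q 0 co1 + x s co1 * q 0 co0 + x s co2 * q 0 co3 - x s co3 * q 0 co2.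
Proof. by rewrite mxE. Qed.

Lemma qmulE2 m (x : 'M[R]_(m, 4)) (q : 'rV[R]_4) s : qmul x q s co2 =
  x s co0 * q 0 co2 - x s co1 * q 0 co3 + x s co2 * q 0 co0 + x s co3 * q 0 co1.
Proof. by rewrite mxE. Qed.

Lemma qmulE3 m (x : 'M[R]_(m, 4)) (q : 'rV[R]_4) s : qmul x q s co3 =
  x s co0 * q 0 co3 + x s co1 * q 0 co2 - x s co2 * q 0 co1 + x s co3 * q 0 co0.
Proof. by rewrite mxE. Qed.

Definition qmulE := (qmulE0, qmulE1, qmulE2, qmulE3).

Lemma sum_I4 (F : 'I_4 -> R) : \sum_t F t = F co0 + F co1 + F co2 + F co3.
Proof.
rewrite !big_ord_recr big_ord0 /= add0r.
by congr (_ + _ + _ + _); congr F; apply: val_inj.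
Qed.

Lemma quatP m (x y : 'M[R]_(m, 4)) :
  (forall s, [/\ x s co0 = y s co0, x s co1 = y s co1, x s co2 = y s co2 & x s co3 = y s co3])
  -> x = y.
Proof.
move=> h; apply/matrixP => s t; have [h0 h1 h2 h3] := h s.
case: t => [[|[|[|[|//]]]]] ht.
- by rewrite (_ : Ordinal ht = co0) //; apply: val_inj.
- by rewrite (_ : Ordinal ht = co1) //; apply: val_inj.
- by rewrite (_ : Ordinal ht = co2) //; apply: val_inj.
- by rewrite (_ : Ordinal ht = co3) //; apply: val_inj.
Qed.

Lemma scaleE (c : R) z t : (c *: z) 0 t = c * z 0 t.
Proof. by rewrite mxE. Qed.

Lemma subE z w t : (z - w) 0 t = z 0 t - w 0 t.
Proof. by rewrite !mxE. Qed.

Lemma qiE t : qi 0 t = (t == co1)%:R :> R. Proof. by rewrite mxE. Qed.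
Lemma qjE t : qj 0 t = (t == co2)%:R :> R. Proof. by rewrite mxE. Qed.
Lemma qkE t : qk 0 t = (t == co3)%:R :> R. Proof. by rewrite mxE. Qed.

Lemma qmulA m (x : 'M[R]_(m, 4)) (z q : 'rV[R]_4) :
  qmul (qmul x z) q = qmul x (qmul z q).
Proof. by apply: quatP => s; rewrite !qmulE; split; ring. Qed.

Lemma qmulZr m (x : 'M[R]_(m, 4)) (c : R) (q : 'rV[R]_4) :
  qmul x (c *: q) = c *: qmul x q.
Proof.
have cE t : (c *: q) 0 t = c * q 0 t by rewrite mxE.
apply: quatP => s.
have xE t : (c *: qmul x q) s t = c * qmul x q s t by rewrite mxE.
by rewrite !xE !qmulE !cE; split; ring.
Qed.

Lemma dot1E z w :
  dot z w = z 0 co0 * w 0 co0 + z 0 co1 * w 0 co1 + z 0 co2 * w 0 co2 + z 0 co3 * w 0 co3.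
Proof. by rewrite /dot big_ord1 sum_I4. Qed.

Lemma derive_qmul m (c : R) (q : 'rV[R]_4) (x v : 'M[R]_(m, 4)) :
  'D_v (fun y => c *: qmul y q) x = c *: qmul v q.
Proof.
rewrite /derive; apply: cvg_lim => //.
apply: (cvg_near_cst (c *: qmul v q)).
near=> t => /=.
have t0 : t != 0 by near: t; exact: nbhs_dnbhs_neq.
have -> : c *: qmul (t *: v + x) q - c *: qmul x q = t *: (c *: qmul v q).
  by apply: quatP => s; split; rewrite !mxE /=; ring.
by rewrite scalerA mulVf// scale1r.
Unshelve. all: by end_near. Qed.

(* [gS3] is bi-invariant, and [v1], [v2], [v3] is a left-invariant orthonormal
   frame with the bracket relations of constant [D] (the values at the identity
   are [D / 2] times [qi], [qj], [qk]). *)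
Lemma Sp1_frame (D : R) : 0 < D ->
  [/\ forall a z v w, dot a a = 1 ->
        gS3 D (qmul a z) (qmul a v) (qmul a w) = gS3 D z v w /\
        gS3 D (qmul z a) (qmul v a) (qmul w a) = gS3 D z v w,
      forall a z, [/\ v1 D (qmul a z) = qmul a (v1 D z),
        v2 D (qmul a z) = qmul a (v2 D z) & v3 D (qmul a z) = qmul a (v3 D z)],
      forall z, dot z z = 1 ->
        [/\ gS3 D z (v1 D z) (v1 D z) = 1, gS3 D z (v2 D z) (v2 D z) = 1,
            gS3 D z (v3 D z) (v3 D z) = 1 &
        [/\ gS3 D z (v1 D z) (v2 D z) = 0, gS3 D z (v2 D z) (v3 D z) = 0 &
            gS3 D z (v3 D z) (v1 D z) = 0]] &
      forall z, [/\ lie_bracket (v1 D) (v2 D) z = D *: v3 D z,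
        lie_bracket (v2 D) (v3 D) z = D *: v1 D z &
        lie_bracket (v3 D) (v1 D) z = D *: v2 D z]].
Proof.
move=> D0; have Dn0 : D != 0 by rewrite gt_eqF.
split.
- move=> a z v w; rewrite dot1E => a1; split; rewrite /gS3 !dot1E !mxE /=;
    congr (_ * _); rewrite -[RHS]mul1r -a1; ring.
- by move=> a z; split; rewrite /v1 /v2 /v3 qmulZr qmulA.
- move=> z; rewrite dot1E => z1.
  have cd1 : (2 / D) ^+ 2 * ((D / 2) * (D / 2)) = 1 by field.
  move: cd1; rewrite /gS3 /v1 /v2 /v3; set c := D / 2; set d := _ ^+ 2 => cd1.
  do !split; rewrite dot1E !scaleE !qmulE !(qiE, qjE, qkE) /=.
  1-3: apply: (etrans _ (etrans (congr2 *%R cd1 z1) (mulr1 1))); ring.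
  1-3: ring.
- move=> z; rewrite /v1 /v2 /v3; have : D = 2 * (D / 2) by field.
  set c := D / 2; move: c => c -> {Dn0 D0 D}.
  split; rewrite /lie_bracket !derive_qmul; apply: quatP => s; rewrite !ord1
    !subE !scaleE !qmulE !scaleE !qmulE !(qiE, qjE, qkE) /=;
    split; ring.
Qed.

End Sp1.

(** * The product manifold and its metric *)

Section Product.
Context {R : realType} {m : nat}.
Let E := ('M[R]_(m, 4) * 'rV[R]_4)%type.
Implicit Types y v w : E.

(* S^{4m-1} x S^1_i, with S^1_i = {a + b i : a^2 + b^2 = 1} in Sp(1) *)
Definition sphere_circle : set E :=
  [set y | dot y.1 y.1 = 1 /\
           [/\ dot y.2 y.2 = 1, y.2 0 co2 = 0 & y.2 0 co3 = 0]].

Definition sphere_circle_tangent y : set E :=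
  [set w | dot y.1 w.1 = 0 /\
           [/\ dot y.2 w.2 = 0, w.2 0 co2 = 0 & w.2 0 co3 = 0]].

Definition gP (A C D p q : R) y v w : R :=
  let b1 := beta1 A C y.1 in
  let b3 := beta3 A C y.1 in
  let s := sigma1 D y.2 in
  gAC A C y.1 v.1 w.1 + s v.2 * s w.2
  + p * (b1 v.1 * s w.2 + s v.2 * b1 w.1)
  + q * (b3 v.1 * s w.2 + s v.2 * b3 w.1).

Definition Tfield (A C : R) y : E := (u1 A C y.1, 0).

End Product.

(* Main.v *)
(** Write [c = sqrt (A C) / 2], so that [T] is the linear field [J y = (c x i, 0)].
  In the flat ambient space the Koszul formula gives, on tangent fields,
  [nabla_U T = J U + B U] and [nabla_T U = D_T U + B U], where [D] is the flat
  derivative and [B] an explicit tensor. As [T] is geodesic, this turns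
  [R(U,T)T] into [- D_T B - 2 B J - B B - J J], which on the normal space is
  [w |-> (A C / 4) w + kappa eta3(w) nu], where [nu] is a multiple of the dual of
  [eta3] and [kappa eta3(nu) = 3 A C / 4]. The choice of [r], [h] and [q] makes
  [nu] and [eta3] parallel along [T], hence also [R_T]. *)

(* The parameters come from two conditions. Duality of [nu] to [L eta3] asks that its [sigma]
   coefficient vanish, which is [rhoE]: [rho (1 - p^2 - q^2) = q]. Parallelism of [nu] along [T]
   asks that the [xi2] terms of [D_T nu] and [B nu] cancel, which forces
   [M^2 / L^2 = q rho / (1 + q rho)]. With [rho = r / h] and [q = r h] one has [q rho = r^2]; the
   second condition becomes [C / A = r^2 / (1 + r^2)] and fixes [r], and the first becomes
   [h^2 (1 + r^2) = 1 - p^2] and fixes [h]. The obstacle is that the connection is an arbitrary one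
   satisfying the axioms, and that its identities hold only on the submanifold, while a second
   covariant derivative takes a whole ambient map as argument. A formula for [nabla X Y] can be
   differentiated again only once [nabla] is known to depend on the restriction of its second
   argument. This rests on the vanishing of tangential derivatives of functions that are zero on the
   submanifold, proved with explicit curves. *)
Require Import Defs.
From HB Require Import structures.
From mathcomp Require Import ring lra zify.
Set Implicit Arguments.
Unset Strict Implicit.
Unset Printing Implicit Defensive.

(** * Smooth maps *)

Section Calculus.
Context {R : realType} {V : normedModType R}.

Lemma derive_comp_linear (W W' : normedModType R) (l : W -> W') (f : V -> W) x v :
  linear l -> continuous l -> differentiable f x ->
  differentiable (fun y => l (f y)) x /\
  'D_v (fun y => l (f y)) x = l ('D_v f x).
Proof.
move=> llin lcont df.
pose lL : {linear W -> W'} := HB.pack l (GRing.isLinear.Build _ _ _ _ _ llin).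
have dl : differentiable lL (f x) by exact: linear_differentiable.
have dlf : differentiable (lL \o f) x by exact: differentiable_comp.
split; first exact: dlf.
by rewrite !deriveE // diff_comp //= (@diff_lin _ _ _ lL).
Qed.

(** The product rule is read off from the differential of a continuous bilinear map, with scalar
    multiplication packed as one. *)
Lemma derive_scale (W : normedModType R) (f : V -> R^o) (g : V -> W) x v :
  differentiable f x -> differentiable g x ->
  differentiable (fun y => f y *: g y) x /\
  'D_v (fun y => f y *: g y) x = 'D_v f x *: g x + f x *: 'D_v g x.
Proof.
move=> df dg.
have bil : bilinear_for (GRing.Scale.Law.clone _ _ *:%R _)
    (GRing.Scale.Law.clone _ _ *:%R _) ( *:%R : R^o -> W -> W).
  split=> [u'|u] a y z /=; first by rewrite scalerDl scalerA.
  by rewrite scalerDr !scalerA mulrC.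
pose b : {bilinear R^o -> W -> W} :=
  HB.pack ( *:%R : R^o -> W -> W) (bilinear_isBilinear.Build R R^o W W _ _ _ bil).
have bcont : continuous (fun p : R^o * W => b p.1 p.2) by exact: scale_continuous.
have dfg : differentiable (fun y => (f y, g y)) x by exact: differentiable_pair.
have db := @differentiable_bilin _ _ _ _ b (f x, g x) bcont.
have d : differentiable ((fun p => b p.1 p.2) \o (fun y => (f y, g y))) x.
  exact: differentiable_comp.
split; first exact: d.
rewrite (deriveE _ d) (diff_comp dfg db) /= (diff_bilin (f:=b) (f x, g x) bcont).
by rewrite diff_pair //= -!deriveE // addrC.
Qed.

Lemma CkW (W : normedModType R) k (f : V -> W) : Ck k.+1 f -> Ck k f.
Proof.
elim: k f => [|k ih] f /=.
  by move=> [df _] x; exact: differentiable_continuous.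
by move=> [df Df]; split => // v; apply: ih; exact: Df.
Qed.

Lemma Ck_cst (W : normedModType R) k (a : W) : Ck k (fun _ : V => a).
Proof.
elim: k a => [|k ih] a; first by move=> x; exact: cvg_cst.
split=> [x|v]; first exact: differentiable_cst.
rewrite [X in Ck _ X](_ : _ = fun=> 0); first exact: ih.
by apply/funext => x; rewrite derive_cst.
Qed.

Lemma CkD (W : normedModType R) k (f g : V -> W) :
  Ck k f -> Ck k g -> Ck k (fun y => f y + g y).
Proof.
elim: k f g => [|k ih] f g /=.
  by move=> fc gc x; apply: cvgD; [exact: fc | exact: gc].
move=> [df Df] [dg Dg]; split=> [x|v]; first exact: differentiableD.
rewrite [X in Ck _ X](_ : _ = fun x => 'D_v f x + 'D_v g x); first exact: ih.
by apply/funext => x; have := deriveD (diff_derivable (v:=v) (df x)) (diff_derivable (v:=v) (dg x)).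
Qed.

Lemma Ck_comp_linear (W W' : normedModType R) (l : W -> W') k (f : V -> W) :
  linear l -> continuous l -> Ck k f -> Ck k (fun y => l (f y)).
Proof.
move=> llin lcont; elim: k f => [|k ih] f /=.
  by move=> fc x; apply: continuous_comp; [exact: fc | exact: lcont].
move=> [df Df]; split=> [x|v]; first by case: (derive_comp_linear 0 llin lcont (df x)).
rewrite [X in Ck _ X](_ : _ = fun x => l ('D_v f x)); first exact: ih.
by apply/funext => x; case: (derive_comp_linear v llin lcont (df x)).
Qed.

(** In each term of the product rule only one factor has lost a derivative; [CkW] lowers the class
    of the other. The explicit fields and forms below are polynomial in the base point, so closure
    under sums, products and linear maps suffices for them. *)
Lemma Ck_scale (W : normedModType R) k (f : V -> R^o) (g : V -> W) :
  Ck k f -> Ck k g -> Ck k (fun y => f y *: g y).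
Proof.
elim: k f g => [|k ih] f g.
  by move=> fc gc x; apply: cvgZ; [exact: fc | exact: gc].
move=> fC gC; have [df Df] := fC; have [dg Dg] := gC.
split=> [x|v]; first by case: (derive_scale 0 (df x) (dg x)).
rewrite [X in Ck _ X](_ : _ = fun x => 'D_v f x *: g x + f x *: 'D_v g x).
  by apply: CkD; apply: ih => //; [exact: Df | exact: CkW | exact: CkW | exact: Dg].
by apply/funext => x; case: (derive_scale v (df x) (dg x)).
Qed.

Lemma smooth_cst (W : normedModType R) (a : W) : smooth (fun _ : V => a).
Proof. by move=> k; exact: Ck_cst. Qed.

Section Smooth.
Context {W : normedModType R}.
Implicit Types f g : V -> W.

Lemma smooth_differentiable f x : smooth f -> differentiable f x.
Proof. by move=> /(_ 1%N) [df _]. Qed.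

Lemma smooth_derivable f x v : smooth f -> derivable f x v.
Proof. by move=> sf; apply/diff_derivable/smooth_differentiable. Qed.

Lemma smoothD f g : smooth f -> smooth g -> smooth (fun y => f y + g y).
Proof. by move=> sf sg k; exact: CkD. Qed.

Lemma smoothZ (f : V -> R^o) g : smooth f -> smooth g -> smooth (fun y => f y *: g y).
Proof. by move=> sf sg k; exact: Ck_scale. Qed.

Lemma smoothZr (a : R) g : smooth g -> smooth (fun y => a *: g y).
Proof. by move=> sg; apply: smoothZ sg; exact: smooth_cst. Qed.

Lemma smoothB f g : smooth f -> smooth g -> smooth (fun y => f y - g y).
Proof.
move=> sf sg; rewrite (_ : (fun y => _) = fun y => f y + (-1) *: g y).
  by apply: smoothD => //; exact: smoothZr.
by apply/funext => y; rewrite scaleN1r.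
Qed.

Lemma smooth_sum (I : finType) (F : I -> V -> W) :
  (forall i, smooth (F i)) -> smooth (fun y => \sum_i F i y).
Proof.
move=> sF; elim: (index_enum I) => [|i s ih].
  by rewrite [X in smooth X](_ : _ = fun=> 0);
    [exact: smooth_cst | apply/funext => y; rewrite big_nil].
rewrite (_ : (fun y => _) = fun y => F i y + \sum_(j <- s) F j y); first exact: smoothD.
by apply/funext => y; rewrite big_cons.
Qed.

Lemma smooth_derive f v : smooth f -> smooth (fun y => 'D_v f y).
Proof. by move=> sf k; have [_] := sf k.+1; apply. Qed.

Lemma derivable_sumT (I : finType) (F : I -> V -> W) x v :
  (forall i, derivable (F i) x v) -> is_derive x v (fun y => \sum_i F i y) (\sum_i 'D_v (F i) x).
Proof.
move=> dF; elim: (index_enum I) => [|i s ih].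
  by rewrite (_ : (fun y => _) = cst 0);
    [rewrite big_nil; exact: is_derive_cst | apply/funext => y; rewrite big_nil].
rewrite (_ : (fun y => _) = F i + (fun y => \sum_(j <- s) F j y)).
  by rewrite big_cons; apply: is_deriveD; exact: derivableP.
by apply/funext => y; rewrite big_cons.
Qed.

Lemma smooth_comp_linear (W' : normedModType R) (l : W -> W') f :
  linear l -> continuous l -> smooth f -> smooth (fun y => l (f y)).
Proof. by move=> llin lcont sf k; exact: Ck_comp_linear. Qed.

End Smooth.

Lemma smooth_id : smooth (fun y : V => y).
Proof.
case=> [|k]; first by move=> x; exact: cvg_id.
split=> [x|v]; first by have [] := is_diff_id x.
rewrite [X in Ck _ X](_ : _ = fun=> v); first exact: Ck_cst.
by apply/funext => x; rewrite derive_id.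
Qed.

End Calculus.

(** * Coordinates on the ambient space; linear and bilinear maps applied to fields *)

Section FiniteDimension.
Context {R : realType} {m : nat}.
Local Notation E := ('M[R]_(m, 4) * 'rV[R]_4)%type.

Definition coord_fun (i : 'I_m * 'I_4 + 'I_4) (v : E) : R^o :=
  match i with inl ij => v.1 ij.1 ij.2 | inr j => v.2 0 j end.

Definition coord_vec (i : 'I_m * 'I_4 + 'I_4) : E :=
  match i with inl ij => (delta_mx ij.1 ij.2, 0) | inr j => (0, delta_mx 0 j) end.

Lemma coord_fun_linear i : linear (coord_fun i).
Proof. by case: i => [ij|j] a u v /=; rewrite !mxE. Qed.

Lemma coord_fun_continuous i : continuous (coord_fun i).
Proof.
case: i => [ij|j] x.
  apply: (@continuous_comp _ _ _ fst (fun M : 'M[R]_(m, 4) => M ij.1 ij.2)).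
    exact: cvg_fst.
  exact: coord_continuous.
apply: (@continuous_comp _ _ _ snd (fun M : 'rV[R]_4 => M 0 j)).
  exact: cvg_snd.
exact: coord_continuous.
Qed.

Lemma coord_sum v : v = \sum_i coord_fun i v *: coord_vec i.
Proof.
rewrite big_sumType /=.
have -> : \sum_ij v.1 ij.1 ij.2 *: ((delta_mx ij.1 ij.2, 0) : E) = (v.1, 0).
  rewrite -(pair_bigA _ (fun i j => v.1 i j *: ((delta_mx i j, 0) : E))) /=.
  rewrite [in RHS](matrix_sum_delta v.1).
  (* The relation [x = (y, 0)] is stable under sums, so it carries the expansion in elementary
     matrices through the inclusion of the first factor. *)
  apply: (big_ind2 (fun (x : E) (y : 'M[R]_(m, 4)) => x = (y, 0))) => //.
    by move=> ? ? ? ? -> ->; rewrite /= -[LHS]/(_, _) addr0.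
  move=> i _; apply: (big_ind2 (fun (x : E) (y : 'M[R]_(m, 4)) => x = (y, 0))) => //.
    by move=> ? ? ? ? -> ->; rewrite /= -[LHS]/(_, _) addr0.
  by move=> j _; rewrite -[LHS]/(_, _) scaler0.
have -> : \sum_j v.2 0 j *: ((0, delta_mx 0 j) : E) = (0, v.2).
  rewrite [in RHS](row_sum_delta v.2).
  apply: (big_ind2 (fun (x : E) (y : 'rV[R]_4) => x = (0, y))) => //.
    by move=> ? ? ? ? -> ->; rewrite /= -[LHS]/(_, _) addr0.
  by move=> j _; rewrite -[LHS]/(_, _) scaler0.
by rewrite -[RHS]/(_, _) addr0 add0r; case: v.
Qed.

Section Maps.
Context {W : normedModType R}.
Implicit Types (l : E -> W) (b : E -> E -> W) (X Y : E -> E).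

Lemma linear_coord l v : linear l -> l v = \sum_i coord_fun i v *: l (coord_vec i).
Proof.
move=> llin; pose lL : {linear E -> W} := HB.pack l (GRing.isLinear.Build _ _ _ _ _ llin).
rewrite {1}(coord_sum v) -[l]/(lL : E -> W) linear_sum.
by apply: eq_bigr => i _; rewrite linearZ.
Qed.

Lemma smooth_coord i X : smooth X -> smooth (fun y => coord_fun i (X y)).
Proof. by apply: smooth_comp_linear; [exact: coord_fun_linear | exact: coord_fun_continuous]. Qed.

Lemma linear_continuousE l : linear l -> continuous l.
Proof.
move=> llin; have sl : smooth l.
  rewrite (_ : l = fun v => \sum_i coord_fun i v *: l (coord_vec i)).
    apply: smooth_sum => i; apply: smoothZ; last exact: smooth_cst.
    by apply: smooth_coord; exact: smooth_id.
  by apply/funext => v; exact: linear_coord.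
exact: (sl 0%N).
Qed.

Lemma smooth_linear l X : linear l -> smooth X -> smooth (fun y => l (X y)).
Proof. by move=> llin; apply: smooth_comp_linear llin (linear_continuousE llin). Qed.

Lemma derive_linear l X x v : linear l -> smooth X -> 'D_v (fun y => l (X y)) x = l ('D_v X x).
Proof.
move=> llin sX.
by case: (derive_comp_linear v llin (linear_continuousE llin) (smooth_differentiable x sX)).
Qed.

Lemma derive_along l x v : smooth l -> 'D_v l x = \sum_i coord_fun i v *: 'D_(coord_vec i) l x.
Proof.
move=> sl; have dl := smooth_differentiable x sl; rewrite deriveE // linear_coord.
  by apply: eq_bigr => i _; rewrite deriveE.
exact: linearP.
Qed.

(** [Ck] speaks of constant directions only; expanding the direction in coordinates allows it to
    vary, as Lie brackets require. *)
Lemma smooth_derive_along l X : smooth l -> smooth X -> smooth (fun y => 'D_(X y) l y).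
Proof.
move=> sl sX.
rewrite (_ : (fun y => _) = fun y => \sum_i coord_fun i (X y) *: 'D_(coord_vec i) l y).
  by apply: smooth_sum => i; apply: smoothZ; [exact: smooth_coord | exact: smooth_derive].
by apply/funext => y; exact: derive_along.
Qed.

Lemma bilinear_coord b u v : (forall w, linear (b^~ w)) ->
  b u v = \sum_i coord_fun i u *: b (coord_vec i) v.
Proof. by move=> bl; exact: (linear_coord u (bl v)). Qed.

Lemma smooth_bilinear b X Y : (forall w, linear (b^~ w)) -> (forall w, linear (b w)) ->
  smooth X -> smooth Y -> smooth (fun y => b (X y) (Y y)).
Proof.
move=> bl br sX sY.
rewrite (_ : (fun y => _) = fun y => \sum_i coord_fun i (X y) *: b (coord_vec i) (Y y)).
  by apply: smooth_sum => i; apply: smoothZ; [exact: smooth_coord | exact: smooth_linear].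
by apply/funext => y; exact: bilinear_coord.
Qed.

(** Expanding the first argument in coordinates reduces the rule to [derive_scale] term by term, so
    joint continuity of [b] is never discussed. *)
Lemma derive_bilinear b X Y x v : (forall w, linear (b^~ w)) -> (forall w, linear (b w)) ->
  smooth X -> smooth Y ->
  'D_v (fun y => b (X y) (Y y)) x = b ('D_v X x) (Y x) + b (X x) ('D_v Y x).
Proof.
move=> bl br sX sY.
rewrite (_ : (fun y => _) = fun y => \sum_i coord_fun i (X y) *: b (coord_vec i) (Y y)); last first.
  by apply/funext => y; exact: bilinear_coord.
have sX' i := smooth_coord i sX.
have sY' i : smooth (fun y => b (coord_vec i) (Y y)) by exact: smooth_linear.
have dF i := derive_scale v (smooth_differentiable x (sX' i)) (smooth_differentiable x (sY' i)).
rewrite (@derive_val _ _ _ _ _ _ _ (derivable_sumT (fun i => diff_derivable (dF i).1))).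
rewrite (bilinear_coord ('D_v X x)) // (bilinear_coord (X x)) // -big_split /=.
apply: eq_bigr => i _; rewrite (dF i).2.
rewrite (derive_linear _ _ (br _) sY); congr (_ *: _ + _).
exact: (derive_comp_linear v (@coord_fun_linear i) (@coord_fun_continuous i)
  (smooth_differentiable x sX)).2.
Qed.

End Maps.
End FiniteDimension.

(** * Quaternionic linear algebra *)

Section Dot.
Context {R : realType} {m : nat}.
Implicit Types (x v w : 'M[R]_(m, 4)) (a : R).

Lemma dotC v w : dot v w = dot w v.
Proof. by apply: eq_bigr => s _; apply: eq_bigr => t _; rewrite mulrC. Qed.

Lemma dotDl x v w : dot (x + v) w = dot x w + dot v w.
Proof.
rewrite -big_split; apply: eq_bigr => s _; rewrite -big_split; apply: eq_bigr => t _ /=.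
by rewrite mxE mulrDl.
Qed.

Lemma dotZl a v w : dot (a *: v) w = a * dot v w.
Proof.
rewrite [RHS]mulr_sumr; apply: eq_bigr => s _; rewrite mulr_sumr; apply: eq_bigr => t _.
by rewrite mxE mulrA.
Qed.

Lemma dotDr x v w : dot x (v + w) = dot x v + dot x w.
Proof. by rewrite dotC dotDl !(dotC x). Qed.

Lemma dotZr a v w : dot v (a *: w) = a * dot v w.
Proof. by rewrite dotC dotZl dotC. Qed.

Lemma dotNl v w : dot (- v) w = - dot v w.
Proof. by rewrite -scaleN1r dotZl mulN1r. Qed.

Lemma dotNr v w : dot v (- w) = - dot v w.
Proof. by rewrite dotC dotNl dotC. Qed.

Lemma dot0l w : dot 0 w = 0.
Proof. by rewrite -[X in dot X](scale0r w) dotZl mul0r. Qed.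

Lemma dot0r w : dot w 0 = 0.
Proof. by rewrite dotC dot0l. Qed.

Definition dotE := (dotDl, dotDr, dotNl, dotNr, dotZl, dotZr, dot0l, dot0r).

Lemma dot_ge0 v : 0 <= dot v v.
Proof. by apply: sumr_ge0 => s _; apply: sumr_ge0 => t _; exact: sqr_ge0. Qed.

Lemma dot_eq0 v : (dot v v == 0) = (v == 0).
Proof.
apply/idP/eqP => [|->]; last by rewrite dot0l.
rewrite psumr_eq0; last by move=> s _; apply: sumr_ge0 => t _; exact: sqr_ge0.
move=> /allP h; apply/matrixP => s t; rewrite mxE.
have := h s; rewrite mem_index_enum => /(_ isT) /=.
rewrite psumr_eq0; last by move=> ? _; exact: sqr_ge0.
by move=> /allP/(_ t); rewrite mem_index_enum => /(_ isT) /=; rewrite mulf_eq0 orbb => /eqP.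
Qed.

Lemma qmulDl x v (u : 'rV[R]_4) : qmul (x + v) u = qmul x u + qmul v u.
Proof. by apply: quatP => s; split; rewrite !mxE /=; ring. Qed.

Lemma qmulZl a x (u : 'rV[R]_4) : qmul (a *: x) u = a *: qmul x u.
Proof. by apply: quatP => s; split; rewrite !mxE /=; ring. Qed.

Lemma qmulNl x (u : 'rV[R]_4) : qmul (- x) u = - qmul x u.
Proof. by rewrite -scaleN1r qmulZl scaleN1r. Qed.

Lemma qmul0l (u : 'rV[R]_4) : qmul (0 : 'M[R]_(m, 4)) u = 0.
Proof. by apply: quatP => s; split; rewrite !mxE /=; ring. Qed.

Local Ltac quat :=
  apply: quatP => s; split; rewrite ?[(- _ : matrix _ _ _) _ _]mxE !qmulE !(qiE, qjE, qkE) /=; ring.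

Lemma qmul_ii x : qmul (qmul x qi) qi = - x. Proof. quat. Qed.
Lemma qmul_ij x : qmul (qmul x qi) qj = qmul x qk. Proof. quat. Qed.
Lemma qmul_ik x : qmul (qmul x qi) qk = - qmul x qj. Proof. quat. Qed.
Lemma qmul_ji x : qmul (qmul x qj) qi = - qmul x qk. Proof. quat. Qed.
Lemma qmul_jj x : qmul (qmul x qj) qj = - x. Proof. quat. Qed.
Lemma qmul_jk x : qmul (qmul x qj) qk = qmul x qi. Proof. quat. Qed.
Lemma qmul_ki x : qmul (qmul x qk) qi = qmul x qj. Proof. quat. Qed.
Lemma qmul_kj x : qmul (qmul x qk) qj = - qmul x qi. Proof. quat. Qed.
Lemma qmul_kk x : qmul (qmul x qk) qk = - x. Proof. quat. Qed.

Local Ltac dotquat :=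
  rewrite /dot -?sumrN; apply: eq_bigr => s _; rewrite !sum_I4 !mxE /=; ring.

Lemma dot_qi v w : dot v (qmul w qi) = - dot (qmul v qi) w. Proof. dotquat. Qed.
Lemma dot_qj v w : dot v (qmul w qj) = - dot (qmul v qj) w. Proof. dotquat. Qed.
Lemma dot_qk v w : dot v (qmul w qk) = - dot (qmul v qk) w. Proof. dotquat. Qed.

Lemma dot_qi_self v : dot (qmul v qi) v = 0.
Proof. by have := dot_qi v v; rewrite dotC; lra. Qed.
Lemma dot_qj_self v : dot (qmul v qj) v = 0.
Proof. by have := dot_qj v v; rewrite dotC; lra. Qed.
Lemma dot_qk_self v : dot (qmul v qk) v = 0.
Proof. by have := dot_qk v v; rewrite dotC; lra. Qed.

Definition qE := (qmulDl, qmulNl, qmulZl, qmul0l, qmul_ii, qmul_ij, qmul_ik, qmul_ji, qmul_jj,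
  qmul_jk, qmul_ki, qmul_kj, qmul_kk, dot_qi, dot_qj, dot_qk, dot_qi_self, dot_qj_self,
  dot_qk_self).

End Dot.

(** * The metric near the foliation *)

Section Forms.
Context {R : realType} {m : nat}.
Local Notation E := ('M[R]_(m, 4) * 'rV[R]_4)%type.
Implicit Types (x : 'M[R]_(m, 4)) (z : 'rV[R]_4) (y v w : E) (a : R).

Definition eta1 (x v : 'M[R]_(m, 4)) : R := dot (xi1 x) v.
Definition eta3 (x v : 'M[R]_(m, 4)) : R := dot (xi3 x) v.

(** On the unit sphere [x], [xi1 x], [xi2 x], [xi3 x] form an orthonormal basis of the quaternionic
    line through [x]. The sphere components of [nu] and [Bop] lie in this line, so the forms are
    evaluated on them by reading off coefficients. *)
Definition frame_comb x (a a1 a2 a3 : R) := a *: x + a1 *: xi1 x + a2 *: xi2 x + a3 *: xi3 x.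

Lemma dot_comb x a a1 a2 a3 (w : 'M[R]_(m, 4)) :
  dot (frame_comb x a a1 a2 a3) w = a * dot x w + a1 * eta1 x w + a2 * eta2 x w + a3 * eta3 x w.
Proof. by rewrite /frame_comb !dotDl !dotZl. Qed.

Lemma dot_xi x : [/\ dot (xi1 x) (xi1 x) = dot x x, dot (xi2 x) (xi2 x) = dot x x,
  dot (xi3 x) (xi3 x) = dot x x &
  [/\ dot (xi1 x) (xi2 x) = 0, dot (xi2 x) (xi3 x) = 0 & dot (xi3 x) (xi1 x) = 0]].
Proof.
rewrite /xi1 /xi2 /xi3 !dot_qi !dot_qj !dot_qk qmul_ii qmul_jj qmul_kk !dotNl !opprK.
by rewrite qmul_ij qmul_jk qmul_ki dot_qk_self dot_qi_self dot_qj_self oppr0.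
Qed.

Lemma eta_comb x a a1 a2 a3 : dot x x = 1 ->
  [/\ dot x (frame_comb x a a1 a2 a3) = a, eta1 x (frame_comb x a a1 a2 a3) = a1,
    eta2 x (frame_comb x a a1 a2 a3) = a2 & eta3 x (frame_comb x a a1 a2 a3) = a3].
Proof.
move=> x1; have [h11 h22 h33 [h12 h23 h31]] := dot_xi x.
have h1 : dot (xi1 x) x = 0 by exact: dot_qi_self.
have h2 : dot (xi2 x) x = 0 by exact: dot_qj_self.
have h3 : dot (xi3 x) x = 0 by exact: dot_qk_self.
rewrite !(dotC _ (frame_comb _ _ _ _ _)) /eta1 /eta2 /eta3 !(dotC _ (frame_comb _ _ _ _ _)).
rewrite !dot_comb /eta1 /eta2 /eta3 h11 h22 h33 (dotC (xi2 x) (xi1 x)) (dotC (xi3 x) (xi2 x)).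
rewrite (dotC (xi1 x) (xi3 x)) !(dotC x (xi1 x), dotC x (xi2 x), dotC x (xi3 x)).
rewrite h12 h23 h31 h1 h2 h3 x1.
by split; ring.
Qed.

Lemma eta_xi1l x (w : 'M[R]_(m, 4)) :
  [/\ eta1 (xi1 x) w = - dot x w, eta2 (xi1 x) w = eta3 x w & eta3 (xi1 x) w = - eta2 x w].
Proof. by rewrite /eta1 /eta2 /eta3 /xi1 /xi2 /xi3 qmul_ii qmul_ij qmul_ik !dotNl; split. Qed.

Lemma eta_xi1r x (w : 'M[R]_(m, 4)) :
  [/\ eta1 w (xi1 x) = dot x w, eta2 w (xi1 x) = - eta3 x w & eta3 w (xi1 x) = eta2 x w].
Proof.
rewrite /eta1 /eta2 /eta3 /xi1 /xi2 /xi3 !dot_qi qmul_ii qmul_ji qmul_ki !dotNl !opprK.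
by rewrite (dotC w x) !(dotC _ x) dot_qj dot_qk opprK; split.
Qed.

(** Right multiplication by [i], [j] or [k] is skew for [dot], so each form is antisymmetric in base
    point and vector. *)
Lemma etaNV x (v : 'M[R]_(m, 4)) :
  [/\ eta1 v x = - eta1 x v, eta2 v x = - eta2 x v & eta3 v x = - eta3 x v].
Proof.
by rewrite /eta1 /eta2 /eta3 /xi1 /xi2 /xi3 -dot_qi -dot_qj -dot_qk !(dotC x); split.
Qed.

Variable D : R.
Hypothesis D0 : 0 < D.

Lemma sigma1E z (v : 'rV[R]_4) : sigma1 D z v = 2 / D * dot (qmul z qi) v.
Proof. by rewrite /sigma1 /gS3 /v1 dotZl; field; rewrite gt_eqF. Qed.

Lemma sigma1_v1 z : dot z z = 1 -> sigma1 D z (v1 D z) = 1.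
Proof. by move=> z1; rewrite sigma1E /v1 !(dotE, qE) z1; field; rewrite gt_eqF. Qed.

Lemma circle_tangentE z (w : 'rV[R]_4) :
  [/\ dot z z = 1, z 0 co2 = 0 & z 0 co3 = 0] ->
  [/\ dot z w = 0, w 0 co2 = 0 & w 0 co3 = 0] -> w = sigma1 D z w *: v1 D z.
Proof.
rewrite !dot1E => -[z1 z2 z3] [zw w2 w3]; move: z1 zw.
rewrite sigma1E dot1E /v1 !mxE /= z2 z3 w2 w3 !(mul0r, mulr0, addr0, subr0, sub0r).
set a := z 0 co0; set b := z 0 co1 => z1 zw.
apply: quatP => s; rewrite !ord1 !mxE /= z2 z3 w2 w3 -/a -/b.
move: zw; set al := w 0 co0; set be := w 0 co1 => zw.
have D0' : D != 0 by rewrite gt_eqF.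
split; [| |by field|by field].
(* Multiply [al] by [a^2 + b^2 = 1] and subtract [a] times the orthogonality relation: what remains
   is a multiple of [b], as in [v1]. *)
- by transitivity (al * (a * a + b * b) - a * (a * al + b * be)); [rewrite z1 zw; ring | field].
- by transitivity (be * (a * a + b * b) - b * (a * al + b * be)); [rewrite z1 zw; ring | field].
Qed.

(** Both vectors are multiples of [z i], and [z i i = - z] is orthogonal to [z i]. This removes the
    derivative of [sigma] in tangent directions from the Koszul formula. *)
Lemma sigma1_tangent z (u w : 'rV[R]_4) :
  [/\ dot z z = 1, z 0 co2 = 0 & z 0 co3 = 0] ->
  [/\ dot z u = 0, u 0 co2 = 0 & u 0 co3 = 0] ->
  [/\ dot z w = 0, w 0 co2 = 0 & w 0 co3 = 0] -> sigma1 D u w = 0.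
Proof.
move=> hz hu hw; rewrite (circle_tangentE hz hu) (circle_tangentE hz hw) sigma1E /v1.
by rewrite !(dotE, qE); ring.
Qed.

Lemma sigma1Dr z (v w : 'rV[R]_4) : sigma1 D z (v + w) = sigma1 D z v + sigma1 D z w.
Proof. by rewrite !sigma1E dotDr mulrDr. Qed.
Lemma sigma1Zr z a (v : 'rV[R]_4) : sigma1 D z (a *: v) = a * sigma1 D z v.
Proof. by rewrite !sigma1E dotZr mulrCA. Qed.
Lemma sigma1Nr z (v : 'rV[R]_4) : sigma1 D z (- v) = - sigma1 D z v.
Proof. by rewrite !sigma1E dotNr mulrN. Qed.
Lemma sigma10r z : sigma1 D z 0 = 0.
Proof. by rewrite !sigma1E dot0r mulr0. Qed.
Lemma sigma1Dl z (v w : 'rV[R]_4) : sigma1 D (v + w) z = sigma1 D v z + sigma1 D w z.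
Proof. by rewrite !sigma1E qmulDl dotDl mulrDr. Qed.
Lemma sigma1Zl z a (v : 'rV[R]_4) : sigma1 D (a *: v) z = a * sigma1 D v z.
Proof. by rewrite !sigma1E qmulZl dotZl mulrCA. Qed.
Lemma sigma10l z : sigma1 D 0 z = 0.
Proof. by rewrite !sigma1E qmul0l dot0l mulr0. Qed.

Variables L p q rho : R.
Hypotheses (L0 : 0 < L) (q0 : 0 < q) (rho0 : 0 < rho)
  (rhoE : rho * (1 - p ^+ 2 - q ^+ 2) = q).

(** Equivalently [1 + b = q rho / (1 + q rho)]. The Koszul formula gives [xi2] the coefficient
    [q / (L^2 (1 + b))] up to sign, which is then the [(1 + q rho) / (L^2 rho)] of [Bop]. *)
Let b : R := - (1 + q * rho)^-1.

(* [gP] in terms of [L = 2 / sqrt (A C)] and [rho = r / h]; the radicals enter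
   the algebra only through [rhoE], and [b = M^2 / L^2 - 1 = C / A - 1]. *)
Definition Gmetric y v w : R :=
  let s := sigma1 D y.2 in
  L ^+ 2 * (dot v.1 w.1 + b * (eta2 y.1 v.1 * eta2 y.1 w.1)) + s v.2 * s w.2
  + p * L * (eta1 y.1 v.1 * s w.2 + s v.2 * eta1 y.1 w.1)
  + q * L * (eta3 y.1 v.1 * s w.2 + s v.2 * eta3 y.1 w.1).

(* The derivative of [fun y => Gmetric y v w] in the direction [u]. *)
Definition dGmetric y u v w : R :=
  let s := sigma1 D y.2 in
  let ds := sigma1 D u.2 in
  L ^+ 2 * (b * (eta2 u.1 v.1 * eta2 y.1 w.1 + eta2 y.1 v.1 * eta2 u.1 w.1))
  + (ds v.2 * s w.2 + s v.2 * ds w.2)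
  + p * L * (eta1 u.1 v.1 * s w.2 + eta1 y.1 v.1 * ds w.2
      + ds v.2 * eta1 y.1 w.1 + s v.2 * eta1 u.1 w.1)
  + q * L * (eta3 u.1 v.1 * s w.2 + eta3 y.1 v.1 * ds w.2
      + ds v.2 * eta3 y.1 w.1 + s v.2 * eta3 u.1 w.1).

(* Applied to the base point, [flow] is the field [T = u1]; being linear, it is
   also the derivative of that field. *)
Definition flow w : E := (L^-1 *: xi1 w.1, 0).

(* A parallel normal field, eigenvector of [R_T] for [A C]; it is dual
   to [L eta3], see [Gmetric_nu]. *)
Definition nu y : E :=
  ((rho * p / L) *: xi1 y.1 + ((1 + q * rho) / L) *: xi3 y.1, - (rho *: v1 D y.2)).

(* The zeroth-order term of [nabla_T]: for tangent [U], [nabla_T U = D_T U + B U]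
   and [nabla_U T = flow U + B U]. *)
Definition Bop y w : E :=
  (L^-1 * eta1 y.1 w.1) *: (y.1, 0) + (b * eta2 y.1 w.1) *: nu y
  - ((1 + q * rho) / (L ^+ 2 * rho) * sigma1 D y.2 w.2) *: (xi2 y.1, 0).

Definition Rop y w : E :=
  L ^- 2 *: w + (3 / (L * (1 + q * rho)) * eta3 y.1 w.1) *: nu y.





Lemma nu_fst y : (nu y).1 = frame_comb y.1 0 (rho * p / L) 0 ((1 + q * rho) / L).
Proof. by rewrite /frame_comb /= !scale0r addr0 add0r. Qed.

Lemma Bop_fst y w : (Bop y w).1 = frame_comb y.1 (L^-1 * eta1 y.1 w.1)
  (b * eta2 y.1 w.1 * (rho * p / L)) (- ((1 + q * rho) / (L ^+ 2 * rho) * sigma1 D y.2 w.2))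
  (b * eta2 y.1 w.1 * ((1 + q * rho) / L)).
Proof.
rewrite /frame_comb /= scalerDr !scalerA scaleNr -!addrA.
by congr (_ + (_ + _)); rewrite addrC.
Qed.

Lemma Bop_snd y w : (Bop y w).2 = - (b * eta2 y.1 w.1 * rho) *: v1 D y.2.
Proof. by rewrite /= scaler0 add0r scaler0 subr0 scalerN scalerA scaleNr. Qed.

Lemma eta_Bop y w : dot y.1 y.1 = 1 -> [/\ dot y.1 (Bop y w).1 = L^-1 * eta1 y.1 w.1,
  eta1 y.1 (Bop y w).1 = b * eta2 y.1 w.1 * (rho * p / L),
  eta2 y.1 (Bop y w).1 = - ((1 + q * rho) / (L ^+ 2 * rho) * sigma1 D y.2 w.2) &
  eta3 y.1 (Bop y w).1 = b * eta2 y.1 w.1 * ((1 + q * rho) / L)].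
Proof. by move=> y1; rewrite Bop_fst; exact: eta_comb. Qed.

Lemma sigma_Bop y w : dot y.2 y.2 = 1 -> sigma1 D y.2 (Bop y w).2 = - (b * eta2 y.1 w.1 * rho).
Proof. by move=> y1; rewrite Bop_snd sigma1Zr sigma1_v1 // mulr1. Qed.

Lemma eta_flowl y (w : 'M[R]_(m, 4)) : [/\ eta1 (flow y).1 w = - (L^-1 * dot y.1 w),
  eta2 (flow y).1 w = L^-1 * eta3 y.1 w & eta3 (flow y).1 w = - (L^-1 * eta2 y.1 w)].
Proof.
have [h1 h2 h3] := eta_xi1l y.1 w; rewrite -[eta2 y.1 w]opprK -h3 -h2 -[dot y.1 w]opprK -h1.
by rewrite /eta1 /eta2 /eta3 /xi1 /xi2 /xi3 /= !qmulZl !dotZl !mulrN !opprK; split.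
Qed.

Lemma eta_flowr y (w : 'M[R]_(m, 4)) : [/\ eta1 w (flow y).1 = L^-1 * dot y.1 w,
  eta2 w (flow y).1 = - (L^-1 * eta3 y.1 w) & eta3 w (flow y).1 = L^-1 * eta2 y.1 w].
Proof.
have [h1 h2 h3] := eta_xi1r y.1 w; rewrite -h3 -[eta3 y.1 w]opprK -h2 -h1.
by rewrite /eta1 /eta2 /eta3 /= !dotZr !mulrN !opprK; split.
Qed.

Let q1n0 : 1 + q * rho != 0.
Proof. by rewrite gt_eqF // addr_gt0 // mulr_gt0. Qed.
Let Ln0 : L != 0. Proof. by rewrite gt_eqF. Qed.
Let rhon0 : rho != 0. Proof. by rewrite gt_eqF. Qed.

(* By the Koszul formula, the right-hand side is [2 g(nabla_v T - flow v, w)]. *)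
Lemma Gmetric_Bop y v w : sphere_circle y ->
  sphere_circle_tangent y v -> sphere_circle_tangent y w ->
  2 * Gmetric y (Bop y v) w =
  dGmetric y (flow y) v w + dGmetric y v (flow y) w - dGmetric y w (flow y) v.
Proof.
move=> [y1 hz] [yv hv] [yw hw].
have y2 : dot y.2 y.2 = 1 by case: hz.
rewrite /Gmetric /dGmetric.
rewrite (sigma1_tangent hz hv hw) (sigma1_tangent hz hw hv).
have [_ B1 B2 B3] := eta_Bop v y1; rewrite B1 B2 B3 (sigma_Bop v y2) Bop_fst dot_comb yw.
have -> : (flow y).2 = 0 by [].
rewrite !sigma10l !sigma10r.
have [-> -> ->] := eta_flowl y v.1; have [-> -> ->] := eta_flowl y w.1.
have [-> -> ->] := eta_flowr y v.1; have [-> -> ->] := eta_flowr y w.1.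
have [_ -> _] := eta_flowr y y.1.
have [_ _ ->] : [/\ True, True & eta3 y.1 y.1 = 0] by split=> //; exact: dot_qk_self.
rewrite yv yw /b.
set e1v := eta1 y.1 v.1; set e2v := eta2 y.1 v.1; set e3v := eta3 y.1 v.1.
set e1w := eta1 y.1 w.1; set e2w := eta2 y.1 w.1; set e3w := eta3 y.1 w.1.
set sv := sigma1 D y.2 v.2; set sw := sigma1 D y.2 w.2.
set rhs := RHS.
(* The two sides differ by a multiple of [rhoE], located at [e2v * sw] because [b eta2] multiplies
   [nu]. Adding that multiple as zero leaves a rational identity. *)
have -> : rhs = rhs + 2 * (1 + q * rho)^-1 * e2v * sw * (rho * (1 - p ^+ 2 - q ^+ 2) - q).
  by rewrite rhoE subrr mulr0 addr0.
rewrite /rhs; field.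
by rewrite Ln0 rhon0 q1n0.
Qed.

(** The derivative of [fun y => Bop y w] in the direction [u], as [derive_Bop] confirms; [dRop]
    plays the same role for [Rop]. *)
Definition dBop y u w : E :=
  (L^-1 * eta1 u.1 w.1) *: (y.1, 0) + (L^-1 * eta1 y.1 w.1) *: (u.1, 0)
  + ((b * eta2 u.1 w.1) *: nu y + (b * eta2 y.1 w.1) *: nu u)
  - (((1 + q * rho) / (L ^+ 2 * rho) * sigma1 D u.2 w.2) *: (xi2 y.1, 0)
     + ((1 + q * rho) / (L ^+ 2 * rho) * sigma1 D y.2 w.2) *: (xi2 u.1, 0)).

Definition dRop y u w : E :=
  (3 / (L * (1 + q * rho)) * eta3 u.1 w.1) *: nu y
  + (3 / (L * (1 + q * rho)) * eta3 y.1 w.1) *: nu u.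

Lemma eta_nu y : dot y.1 y.1 = 1 -> [/\ dot y.1 (nu y).1 = 0,
  eta1 y.1 (nu y).1 = rho * p / L, eta2 y.1 (nu y).1 = 0 &
  eta3 y.1 (nu y).1 = (1 + q * rho) / L].
Proof. by move=> y1; rewrite nu_fst; exact: eta_comb. Qed.

Lemma sigma_nu y : dot y.2 y.2 = 1 -> sigma1 D y.2 (nu y).2 = - rho.
Proof. by move=> y1; rewrite /= sigma1Nr sigma1Zr sigma1_v1 // mulr1. Qed.

Lemma eta_flow x w : dot x w.1 = 0 -> [/\ eta1 x (flow w).1 = 0,
  eta2 x (flow w).1 = L^-1 * eta3 x w.1 & eta3 x (flow w).1 = - (L^-1 * eta2 x w.1)].
Proof.
move=> xw; have [-> -> ->] := eta_flowr w x; have [_ -> ->] := etaNV x w.1.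
by rewrite dotC xw mulr0 !mulrN opprK.
Qed.

Lemma xi1_flow y : xi1 (flow y).1 = - (L^-1 *: y.1).
Proof. by rewrite /xi1 /= qmulZl qmul_ii scalerN. Qed.
Lemma xi2_flow y : xi2 (flow y).1 = L^-1 *: xi3 y.1.
Proof. by rewrite /xi2 /= qmulZl qmul_ij. Qed.
Lemma xi3_flow y : xi3 (flow y).1 = - (L^-1 *: xi2 y.1).
Proof. by rewrite /xi3 /= qmulZl qmul_ik scalerN. Qed.

Lemma v1_0 : v1 D 0 = 0.
Proof. by rewrite /v1 qmul0l scaler0. Qed.

(* The left-hand side is [R(U,T)T] expanded with [nabla_T = D_T + B]; the
   derivatives of [U] cancel. *)
Lemma Rop_eq y w : sphere_circle y -> sphere_circle_tangent y w ->
  L * eta1 y.1 w.1 + p * sigma1 D y.2 w.2 = 0 ->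
  - dBop y (flow y) w - (Bop y (flow w) + Bop y (flow w)) - Bop y (Bop y w) - flow (flow w)
  = Rop y w.
Proof.
move=> [y1 hz] [yw hw] nw.
have y2 : dot y.2 y.2 = 1 by case: hz.
(* The hypothesis [nw] is orthogonality to [T], see [Gmetric_flow]; it eliminates [eta1] in favour
   of [sigma]. *)
have e1 : eta1 y.1 w.1 = - (L^-1 * p * sigma1 D y.2 w.2).
  transitivity (L^-1 * (L * eta1 y.1 w.1 + p * sigma1 D y.2 w.2) - L^-1 * p * sigma1 D y.2 w.2).
    by field.
  by rewrite nw mulr0 sub0r.
have [_ B1 B2 _] := eta_Bop w y1; have sB := sigma_Bop w y2.
have [F1 F2 _] := eta_flow yw.
have [G1 G2 _] := eta_flowl y w.1.
have s0 : sigma1 D y.2 (flow w).2 = 0 by exact: sigma10r.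
have s0' : sigma1 D (flow y).2 w.2 = 0 by exact: sigma10l.
have w2 : w.2 = sigma1 D y.2 w.2 *: v1 D y.2 by exact: circle_tangentE.
(* The outer [Bop] sees its argument only through [eta1], [eta2] and [sigma], so the inner one can
   be made opaque. *)
move: (Bop y w) B1 B2 sB => Bw B1 B2 sB.
rewrite /dBop /Rop /Bop B1 B2 sB F1 F2 G1 G2 s0 s0' yw e1 /nu.
rewrite xi1_flow xi2_flow xi3_flow.
have ff : flow (flow w) = (- (L^-1 *: (L^-1 *: w.1)), 0).
  by rewrite /flow /xi1 /= qmulZl qmul_ii !scalerN.
rewrite ff /b; congr pair; rewrite /=.
  apply/matrixP => i j.
  move: (eta2 y.1 w.1) (eta3 y.1 w.1) (sigma1 D y.2 w.2) => g2 g3 s.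
  move: (xi1 y.1) (xi2 y.1) (xi3 y.1) => f1 f2 f3; rewrite !mxE; field.
  by rewrite Ln0 rhon0 q1n0.
(* On the circle factor [flow] vanishes and [Bop] yields multiples of [v1], so [w.2] has to be
   written as one too. *)
rewrite [in RHS]w2 v1_0; apply/matrixP => i j.
move: (eta2 y.1 w.1) (eta3 y.1 w.1) (sigma1 D y.2 w.2) => g2 g3 s.
move: (v1 D y.2) => V; rewrite !mxE; field.
by rewrite Ln0 rhon0 q1n0.
Qed.

Lemma Bop_linear y : linear (Bop y).
Proof.
move=> a u w.
have e1 : eta1 y.1 (a *: u + w).1 = a * eta1 y.1 u.1 + eta1 y.1 w.1 by rewrite /eta1 dotDr dotZr.
have e2 : eta2 y.1 (a *: u + w).1 = a * eta2 y.1 u.1 + eta2 y.1 w.1 by rewrite /eta2 dotDr dotZr.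
have es : sigma1 D y.2 (a *: u + w).2 = a * sigma1 D y.2 u.2 + sigma1 D y.2 w.2.
  by rewrite sigma1Dr sigma1Zr.
rewrite /Bop e1 e2 es.
move: (eta1 y.1 u.1) (eta2 y.1 u.1) (sigma1 D y.2 u.2)
  (eta1 y.1 w.1) (eta2 y.1 w.1) (sigma1 D y.2 w.2).
move: (nu y) (xi2 y.1) => [n n'] f2 g1 g2 s h1 h2 t.
by congr pair => /=; apply/matrixP => i j; rewrite !mxE; ring.
Qed.

(** With [nabla_T = D_T + B] this is the covariant derivative of [Rop] along [T], namely
    [D_T R + B R - R B]. The multiple of the identity commutes with [B], and the rank-one part is
    parallel because [nu] and [eta3] are. *)
Lemma Rop_parallel y w : sphere_circle y -> sphere_circle_tangent y w ->
  dRop y (flow y) w + Bop y (Rop y w) - Rop y (Bop y w) = 0.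
Proof.
move=> [y1 hz] [yw hw].
have y2 : dot y.2 y.2 = 1 by case: hz.
have [_ B1 B2 B3] := eta_Bop w y1; have sB := sigma_Bop w y2.
have [_ N1 N2 N3] := eta_nu y1; have sN := sigma_nu y2.
have [_ _ G3] := eta_flowl y w.1.
set k := 3 / (L * (1 + q * rho)).
have R1 : eta1 y.1 (Rop y w).1 = L ^- 2 * eta1 y.1 w.1 + k * eta3 y.1 w.1 * (rho * p / L).
  by rewrite [LHS]dotDr !dotZr -N1.
have R2 : eta2 y.1 (Rop y w).1 = L ^- 2 * eta2 y.1 w.1.
  by rewrite [LHS]dotDr !dotZr [dot _ (nu y).1]N2 mulr0 addr0.
have sR : sigma1 D y.2 (Rop y w).2 = L ^- 2 * sigma1 D y.2 w.2 - k * eta3 y.1 w.1 * rho.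
  by rewrite sigma1Dr !sigma1Zr sN mulrN.
have nuflow : nu (flow y) =
    (- ((rho * p / L ^+ 2) *: y.1 + ((1 + q * rho) / L ^+ 2) *: xi2 y.1), 0).
  rewrite /nu xi1_flow xi3_flow v1_0 scaler0 oppr0 !scalerN !scalerA opprD.
  by congr ((- (_ *: _) - _ *: _), _); field.
rewrite /dRop /Bop R1 R2 sR nuflow G3 /Rop -/k B3 /Bop /nu.
congr pair; rewrite /= /b.
  apply/matrixP => i j.
  move: (eta1 y.1 w.1) (eta2 y.1 w.1) (eta3 y.1 w.1) (sigma1 D y.2 w.2) => g1 g2 g3 s.
  move: (xi1 y.1) (xi2 y.1) (xi3 y.1) => f1 f2 f3; rewrite !mxE /k; field.
  by rewrite Ln0 rhon0 q1n0.
apply/matrixP => i j.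
move: (eta1 y.1 w.1) (eta2 y.1 w.1) (eta3 y.1 w.1) (sigma1 D y.2 w.2) => g1 g2 g3 s.
move: (v1 D y.2) => V; rewrite !mxE /k; field.
by rewrite Ln0 rhon0 q1n0.
Qed.

Lemma GmetricC y v w : Gmetric y v w = Gmetric y w v.
Proof. by rewrite /Gmetric dotC; ring. Qed.

Lemma GmetricDl y a u v w : Gmetric y (a *: u + v) w = a * Gmetric y u w + Gmetric y v w.
Proof.
rewrite /Gmetric /eta1 /eta2 /eta3 /= sigma1Dr sigma1Zr !dotDl !dotDr !dotZl !dotZr; ring.
Qed.

(** Turns normality to [T] into a linear equation in [eta1] and [sigma]. *)
Lemma Gmetric_flow y w : sphere_circle y ->
  Gmetric y (flow y) w = L * eta1 y.1 w.1 + p * sigma1 D y.2 w.2.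
Proof.
move=> [y1 _]; rewrite /Gmetric; have [-> _ _] := eta_flowr y y.1.
have -> : eta2 y.1 (flow y).1 = 0.
  by have [_ -> _] := eta_flowr y y.1; rewrite /eta3 [dot _ _]dot_qk_self mulr0 oppr0.
have -> : eta3 y.1 (flow y).1 = 0.
  by have [_ _ ->] := eta_flowr y y.1; rewrite /eta2 [dot _ _]dot_qj_self mulr0.
by rewrite y1 sigma10r /= dotZl -/(eta1 _ _); field.
Qed.

(** The [eta1] terms cancel, and the coefficient of [sigma] is [- rho + p^2 rho + q (1 + q rho) = q
    - rho (1 - p^2 - q^2)], which is zero by [rhoE]. *)
Lemma Gmetric_nu y w : sphere_circle y -> dot y.1 w.1 = 0 -> Gmetric y (nu y) w = L * eta3 y.1 w.1.
Proof.
move=> [y1 [y2 _ _]] yw; have [_ N1 N2 N3] := eta_nu y1; have sN := sigma_nu y2.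
rewrite /Gmetric N1 N2 N3 sN nu_fst dot_comb yw.
set rhs := RHS.
have -> : rhs = rhs + sigma1 D y.2 w.2 * (q - rho * (1 - p ^+ 2 - q ^+ 2)).
  by rewrite rhoE subrr mulr0 addr0.
by rewrite /rhs; field.
Qed.

(** Completing the squares in [L e1 + p s] and [L e3 + q s] leaves [(1 - p^2 - q^2) s^2], which is
    [(q / rho) s^2] by [rhoE], while [e2] keeps the positive weight [L^2 (1 + b)]. *)
Lemma Gmetric_gt0 y v : sphere_circle y -> sphere_circle_tangent y v -> v != 0 ->
  0 < Gmetric y v v.
Proof.
move=> [y1 hz] [yv hv] v0.
set e1 := eta1 y.1 v.1; set e2 := eta2 y.1 v.1; set e3 := eta3 y.1 v.1.
set s := sigma1 D y.2 v.2.
(* The defect in Bessel's inequality is the squared length of the component orthogonal to the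
   quaternionic line. *)
have uE : dot v.1 v.1 - e1 ^+ 2 - e2 ^+ 2 - e3 ^+ 2 =
    dot (v.1 - frame_comb y.1 0 e1 e2 e3) (v.1 - frame_comb y.1 0 e1 e2 e3).
  have [c0 c1 c2 c3] := eta_comb 0 e1 e2 e3 y1.
  have FF := dot_comb y.1 0 e1 e2 e3 (frame_comb y.1 0 e1 e2 e3).
  have Fv := dot_comb y.1 0 e1 e2 e3 v.1.
  rewrite dotDl dotNl !dotDr !dotNr (dotC v.1 (frame_comb _ _ _ _ _)) FF Fv c1 c2 c3 -/e1 -/e2 -/e3.
  ring.
have GE : Gmetric y v v =
    L ^+ 2 * (dot v.1 v.1 - e1 ^+ 2 - e2 ^+ 2 - e3 ^+ 2)
    + L ^+ 2 * (q * rho / (1 + q * rho)) * e2 ^+ 2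
    + (L * e1 + p * s) ^+ 2 + (L * e3 + q * s) ^+ 2 + q / rho * s ^+ 2.
  rewrite /Gmetric -/e1 -/e2 -/e3 -/s.
  have -> : q / rho = 1 - p ^+ 2 - q ^+ 2 by rewrite -[in LHS]rhoE; field.
  by rewrite /b; field.
have k1 : 0 < q / rho by rewrite divr_gt0.
have k2 : 0 < L ^+ 2 * (q * rho / (1 + q * rho)).
  by rewrite mulr_gt0 ?exprn_gt0 // divr_gt0 ?mulr_gt0 // addr_gt0 // mulr_gt0.
have L20 : 0 < L ^+ 2 by rewrite exprn_gt0.
have u0 : 0 <= dot v.1 v.1 - e1 ^+ 2 - e2 ^+ 2 - e3 ^+ 2 by rewrite uE dot_ge0.
have t1 : 0 <= L ^+ 2 * (dot v.1 v.1 - e1 ^+ 2 - e2 ^+ 2 - e3 ^+ 2) by rewrite mulr_ge0 // ltW.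
have t2 : 0 <= L ^+ 2 * (q * rho / (1 + q * rho)) * e2 ^+ 2 by rewrite mulr_ge0 ?sqr_ge0 // ltW.
have t5 : 0 <= q / rho * s ^+ 2 by rewrite mulr_ge0 ?sqr_ge0 // ltW.
have t3 := sqr_ge0 (L * e1 + p * s); have t4 := sqr_ge0 (L * e3 + q * s).
rewrite lt_neqAle; apply/andP; split; last by rewrite GE !addr_ge0.
apply: contraNneq v0 => /esym G0.
rewrite GE in G0.
have z5 : q / rho * s ^+ 2 = 0 by lra.
have s0 : s = 0 by apply/eqP; move/eqP: z5; rewrite mulf_eq0 sqrf_eq0 gt_eqF.
have z4 : (L * e3 + q * s) ^+ 2 = 0 by lra.
have z3 : (L * e1 + p * s) ^+ 2 = 0 by lra.
have z2 : L ^+ 2 * (q * rho / (1 + q * rho)) * e2 ^+ 2 = 0 by lra.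
have e2_0 : e2 = 0 by apply/eqP; move/eqP: z2; rewrite mulf_eq0 sqrf_eq0 gt_eqF.
have e1_0 : e1 = 0.
  by apply/eqP; move/eqP: z3; rewrite s0 mulr0 addr0 sqrf_eq0 mulf_eq0 (negPf Ln0).
have e3_0 : e3 = 0.
  by apply/eqP; move/eqP: z4; rewrite s0 mulr0 addr0 sqrf_eq0 mulf_eq0 (negPf Ln0).
have z1 : L ^+ 2 * (dot v.1 v.1 - e1 ^+ 2 - e2 ^+ 2 - e3 ^+ 2) = 0 by lra.
have v10 : v.1 = 0.
  apply/eqP; rewrite -dot_eq0; move/eqP: z1.
  by rewrite e1_0 e2_0 e3_0 expr0n /= !subr0 mulf_eq0 gt_eqF.
have v20 : v.2 = 0 by rewrite (circle_tangentE hz hv) -/s s0 scale0r.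
by rewrite [v]surjective_pairing v10 v20.
Qed.

End Forms.

(** * Tangential derivatives of functions vanishing on the submanifold *)

Section Vanishing.
Context {R : realType} {m : nat}.
Local Notation E := ('M[R]_(m, 4) * 'rV[R]_4)%type.

(* Half-angle parametrisation of a circle through [x] with velocity [v] at [t = 0]:
   it is rational, so that only inverses have to be differentiated. *)
Lemma dot_curve n (x v : 'M[R]_(n, 4)) (t : R) : dot x x = 1 -> dot x v = 0 ->
  let c := (1 + dot v v / 4 * t ^+ 2)^-1 in
  dot ((2 * c - 1) *: x + (t * c) *: v) ((2 * c - 1) *: x + (t * c) *: v) = 1.
Proof.
move=> x1 xv c; rewrite !(dotDl, dotDr) !(dotZl, dotZr) (dotC v x) x1 xv.
have c0 : 1 + dot v v / 4 * t ^+ 2 != 0.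
  by rewrite gt_eqF // ltr_pwDl // mulr_ge0 ?sqr_ge0 // divr_ge0 // dot_ge0.
by rewrite /c; field; rewrite (_ : 4 + _ = 4 * (1 + dot v v / 4 * t ^+ 2)) ?mulf_neq0 //; field.
Qed.

(** The function is even, hence stationary at 0: the coefficient of the base point does not
    contribute to the velocity of the curve. *)
Lemma is_derive_curve_coef (k : R) :
  is_derive (0 : R) 1 (fun t : R => (1 + k * t ^+ 2)^-1 : R) 0.
Proof.
have dg : is_derive (0 : R) 1 (cst (1 : R) + k *: ((@id R) ^+ 2)) 0.
  have d2 : is_derive (0 : R) 1 ((@id R) ^+ 2) 0.
    apply: (is_derive_eq (@is_deriveX _ _ (@id R) 2 0 1 1 (is_derive_id _ _))).
    by rewrite (expr1 0) mulr0 scale0r.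
  apply: (is_derive_eq (is_deriveD (is_derive_cst _ _ _) (is_deriveZ k d2))).
  by rewrite scaler0 addr0.
have gE t : (cst (1 : R) + k *: ((@id R) ^+ 2)) t = 1 + k * t ^+ 2 by [].
have g0 : (cst (1 : R) + k *: ((@id R) ^+ 2)) 0 != 0.
  by rewrite gE expr0n mulr0 addr0 oner_neq0.
apply: DeriveDef; first by apply: derivableV => //; case: dg.
rewrite (deriveV g0); last by case: dg.
by rewrite derive_val scaler0.
Qed.

(** One curve in each factor gives a curve in the submanifold through [y] with velocity [v], along
    which [f] is zero. In the second factor position and velocity both lack [j] and [k] components,
    so the curve stays in the circle. *)
Lemma derive_tangent_eq0 (W : normedModType R) (f : E -> W) (y v : E) :
  differentiable f y -> (forall z, sphere_circle z -> f z = 0) ->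
  sphere_circle y -> sphere_circle_tangent y v -> 'D_v f y = 0.
Proof.
move=> df f0 [y1 [y2 y22 y23]] [yv1 [yv2 v22 v23]].
pose c1 (t : R) : R := (1 + dot v.1 v.1 / 4 * t ^+ 2)^-1.
pose c2 (t : R) : R := (1 + dot v.2 v.2 / 4 * t ^+ 2)^-1.
pose g (t : R) : E := ((2 * c1 t - 1) *: y.1 + (t * c1 t) *: v.1,
                       (2 * c2 t - 1) *: y.2 + (t * c2 t) *: v.2).
have gM t : sphere_circle (g t).
  split; first exact: dot_curve.
  by split; [exact: dot_curve | rewrite !mxE y22 v22 !mulr0 addr0 | rewrite !mxE y23 v23 !mulr0 addr0].
have c0 (k : R) : (1 + k * 0 ^+ 2)^-1 = 1 :> R by rewrite expr0n mulr0 addr0 invr1.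
have dpart n (x u : 'M[R]_(n, 4)) (c : R -> R) : is_derive (0 : R) 1 c 0 -> c 0 = 1 ->
    is_derive (0 : R) 1 (fun t => (2 * c t - 1) *: x + (t * c t) *: u) u.
  move=> dc c01.
  have da : is_derive (0 : R) 1 (2 *: c - cst 1) 0.
    by apply: is_derive_eq; rewrite scaler0 subr0.
  have db : is_derive (0 : R) 1 ((@id R) * c) 1.
    by apply: is_derive_eq; rewrite c01 scaler0 add0r /= [_ *: _]mulr1.
  have dfa : differentiable (2 *: c - cst 1 : R -> R) 0 by apply/derivable1_diffP; case: da.
  have dfb : differentiable ((@id R) * c : R -> R) 0 by apply/derivable1_diffP; case: db.
  have [d1 e1] := derive_scale (V:=R) (1 : R) dfa (differentiable_cst x (0 : R)).
  have [d2 e2] := derive_scale (V:=R) (1 : R) dfb (differentiable_cst u (0 : R)).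
  have h1 := derivableP (diff_derivable (v:=(1 : R)) d1).
  have h2 := derivableP (diff_derivable (v:=(1 : R)) d2).
  have h := is_derive_eq (is_deriveD h1 h2); apply: (h u).
  apply: (etrans (congr2 +%R e1 e2)); rewrite !derive_cst !scaler0 !addr0.
  rewrite (@derive_val _ _ _ _ _ _ _ da) (@derive_val _ _ _ _ _ _ _ db).
  by rewrite scale0r add0r scale1r.
have g1 := dpart _ y.1 v.1 c1 (is_derive_curve_coef _) (c0 _).
have g2 := dpart _ y.2 v.2 c2 (is_derive_curve_coef _) (c0 _).
have dg1 : differentiable (fun t => (2 * c1 t - 1) *: y.1 + (t * c1 t) *: v.1) (0 : R).
  by apply/derivable1_diffP; case: g1.
have dg2 : differentiable (fun t => (2 * c2 t - 1) *: y.2 + (t * c2 t) *: v.2) (0 : R).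
  by apply/derivable1_diffP; case: g2.
have dg : differentiable g (0 : R) by exact: differentiable_pair.
have g0 : g 0 = y.
  rewrite /g /c1 /c2 !c0 !mul0r !scale0r !addr0 mulr1.
  have -> : 2 - 1 = 1 :> R by ring.
  by rewrite !scale1r -surjective_pairing.
have dgv : 'd g (0 : R) 1 = v.
  rewrite diff_pair //= -!deriveE //.
  by rewrite !derive_val -surjective_pairing.
have df' : differentiable f (g 0) by rewrite g0.
have : 'D_1 (f \o g) (0 : R) = 'D_v f y.
  rewrite deriveE; last exact: differentiable_comp.
  by rewrite diff_comp //= dgv g0 -deriveE.
move=> <-; rewrite (_ : f \o g = cst 0) ?derive_cst //.
by apply/funext => t /=; exact: f0.
Qed.

End Vanishing.

(** * Smoothness and flat derivatives of the explicit tensors *)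

Section Derivatives.
Context {R : realType} {m : nat}.
Local Notation E := ('M[R]_(m, 4) * 'rV[R]_4)%type.
Variables D L p q rho : R.
Hypothesis D0 : 0 < D.
Local Notation G := (Gmetric D L p q rho).
Local Notation dG := (dGmetric D L p q rho).
Local Notation nu := (nu D L p q rho).
Local Notation B := (Bop D L p q rho).
Local Notation dB := (dBop D L p q rho).
Local Notation Rop := (Rop D L p q rho).
Local Notation dRop := (dRop D L p q rho).
Implicit Types (y v w : E) (X Y Z : E -> E).

(** The forms are linear in the base point as well as in the vector, so differentiating the base
    point along [v] amounts to replacing it by [v]. *)
Definition bilin (b : E -> E -> R^o) := (forall w, linear (b^~ w)) /\ (forall w, linear (b w)).

Lemma bilin_eta1 : bilin (fun y w => eta1 y.1 w.1).
Proof.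
split=> w a u v; rewrite /eta1 /xi1 /= ?qmulDl ?qmulZl ?dotDl ?dotZl //.
by rewrite dotDr dotZr.
Qed.

Lemma bilin_eta2 : bilin (fun y w => eta2 y.1 w.1).
Proof.
split=> w a u v; rewrite /eta2 /xi2 /= ?qmulDl ?qmulZl ?dotDl ?dotZl //.
by rewrite dotDr dotZr.
Qed.

Lemma bilin_eta3 : bilin (fun y w => eta3 y.1 w.1).
Proof.
split=> w a u v; rewrite /eta3 /xi3 /= ?qmulDl ?qmulZl ?dotDl ?dotZl //.
by rewrite dotDr dotZr.
Qed.

Lemma bilin_sigma : bilin (fun y w => sigma1 D y.2 w.2).
Proof.
split=> w a u v; first by rewrite (sigma1Dl D0) (sigma1Zl D0).
by rewrite (sigma1Dr D0) (sigma1Zr D0).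
Qed.

Lemma bilin_dot : bilin (fun y w => dot y.1 w.1).
Proof. by split=> w a u v; rewrite /= ?(dotDl, dotDr) ?(dotZl, dotZr). Qed.

Lemma is_derive_bilin b X Z x v : bilin b -> smooth X -> smooth Z ->
  is_derive x v (fun y => b (X y) (Z y)) (b ('D_v X x) (Z x) + b (X x) ('D_v Z x)).
Proof.
move=> [bl br] sX sZ; apply: DeriveDef; last exact: derive_bilinear.
exact: smooth_derivable (smooth_bilinear bl br sX sZ).
Qed.

Lemma is_derive_form b X x v : bilin b -> smooth X ->
  is_derive x v (fun y => b y (X y)) (b v (X x) + b x ('D_v X x)).
Proof. by move=> bb sX; have := is_derive_bilin x v bb smooth_id sX; rewrite derive_id. Qed.

Lemma smooth_form b X : bilin b -> smooth X -> smooth (fun y => b y (X y)).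
Proof. by move=> [bl br] sX; apply: smooth_bilinear bl br _ sX; exact: smooth_id. Qed.

Lemma smoothM (f g : E -> R^o) : smooth f -> smooth g -> smooth (fun y => f y * g y : R^o).
Proof. exact: smoothZ. Qed.

Lemma smooth_Gmetric X Z : smooth X -> smooth Z -> smooth (fun y => G y (X y) (Z y) : R^o).
Proof.
move=> sX sZ.
have s1X := smooth_form bilin_eta1 sX; have s1Z := smooth_form bilin_eta1 sZ.
have s2X := smooth_form bilin_eta2 sX; have s2Z := smooth_form bilin_eta2 sZ.
have s3X := smooth_form bilin_eta3 sX; have s3Z := smooth_form bilin_eta3 sZ.
have ssX := smooth_form bilin_sigma sX; have ssZ := smooth_form bilin_sigma sZ.
have [dl dr] := bilin_dot; have sd := smooth_bilinear dl dr sX sZ.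
have cst (a : R) : smooth (fun _ : E => a : R^o) by exact: smooth_cst.
rewrite /Gmetric.
apply: smoothD; last by apply: smoothM => //; apply: smoothD; exact: smoothM.
apply: smoothD; last by apply: smoothM => //; apply: smoothD; exact: smoothM.
apply: smoothD; last exact: smoothM.
apply: smoothM => //; apply: smoothD => //.
by apply: smoothM => //; exact: smoothM.
Qed.

Lemma derive_Gmetric X Z x v : smooth X -> smooth Z ->
  'D_v (fun y => G y (X y) (Z y) : R^o) x =
  dG x v (X x) (Z x) + G x ('D_v X x) (Z x) + G x (X x) ('D_v Z x).
Proof.
move=> sX sZ.
have d1X := is_derive_form x v bilin_eta1 sX; have d1Z := is_derive_form x v bilin_eta1 sZ.
have d2X := is_derive_form x v bilin_eta2 sX; have d2Z := is_derive_form x v bilin_eta2 sZ.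
have d3X := is_derive_form x v bilin_eta3 sX; have d3Z := is_derive_form x v bilin_eta3 sZ.
have dsX := is_derive_form x v bilin_sigma sX; have dsZ := is_derive_form x v bilin_sigma sZ.
have dd := is_derive_bilin x v bilin_dot sX sZ.
pose b := - (1 + q * rho)^-1.
have d := is_deriveD (is_deriveD (is_deriveD
  (is_deriveZ (L ^+ 2) (is_deriveD dd (is_deriveZ b (is_deriveM d2X d2Z))))
  (is_deriveM dsX dsZ))
  (is_deriveZ (p * L) (is_deriveD (is_deriveM d1X dsZ) (is_deriveM dsX d1Z))))
  (is_deriveZ (q * L) (is_deriveD (is_deriveM d3X dsZ) (is_deriveM dsX d3Z))).
apply: (etrans (@derive_val _ _ _ _ _ _ _ d)).
have scE (a c : R) : (a *: (c : R^o) : R^o) = a * c by [].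
rewrite !scE /dGmetric /Gmetric -/b.
move: {d dd d1X d1Z d2X d2Z d3X d3Z dsX dsZ} b (X x) (Z x) ('D_v X x) ('D_v Z x)
  (@eta1 R m) (@eta2 R m) (@eta3 R m) (@sigma1 R D) (@dot R m).
by move=> b u w u' w' f1 f2 f3 f4 f5; cbv beta; ring.
Qed.

Lemma flow_linear : linear (flow L : E -> E).
Proof.
move=> a u v; rewrite /flow /xi1 /= qmulDl qmulZl; congr pair => /=.
  by rewrite scalerDr !scalerA mulrC.
by rewrite scaler0 addr0.
Qed.

Lemma nu_linear : linear (nu : E -> E).
Proof.
move=> a u v; rewrite /nu /xi1 /xi3 /v1 /= !qmulDl !qmulZl.
move: (qmul u.1 qi) (qmul u.1 qk) (qmul v.1 qi) (qmul v.1 qk) (qmul u.2 qi) (qmul v.2 qi).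
by move=> a1 a2 a3 a4 a5 a6; congr pair => /=; apply/matrixP => i j; rewrite !mxE; ring.
Qed.

Lemma base_linear : linear (fun y : E => (y.1, 0) : E).
Proof. by move=> a u v; congr pair => /=; rewrite scaler0 addr0. Qed.

Lemma xi2_linear : linear (fun y : E => (xi2 y.1, 0) : E).
Proof. by move=> a u v; rewrite /xi2 /= qmulDl qmulZl; congr pair => /=; rewrite scaler0 addr0. Qed.

(** Every summand of [Bop], and the rank-one part of [Rop], has this shape: a form times a field
    that is linear in the base point. *)
Lemma derive_form_scale b (a : R) (l : E -> E) X x v : bilin b -> linear l -> smooth X ->
  is_derive x v (fun y => (a * b y (X y)) *: l y)
    ((a * b v (X x)) *: l x + (a * b x (X x)) *: l v + (a * b x ('D_v X x)) *: l x).
Proof.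
move=> bb ll sX.
have sb := smooth_form bb sX; have db := is_derive_form x v bb sX.
have dab := is_deriveZ a db.
have sl : smooth l := smooth_linear ll smooth_id.
have sab : smooth (fun y => a *: b y (X y) : R^o) by exact: smoothZr.
have [d e] := derive_scale v (smooth_differentiable x sab) (smooth_differentiable x sl).
apply: DeriveDef; first exact: diff_derivable d.
apply: (etrans e).
rewrite (derive_linear x v ll smooth_id) derive_id.
rewrite (_ : 'D_v (fun y => a *: b y (X y) : R^o) x = a * (b v (X x) + b x ('D_v X x))).
  by rewrite mulrDr scalerDl addrAC.
exact: (@derive_val _ _ _ _ _ _ _ dab).
Qed.

Lemma smooth_form_scale b (a : R) (l : E -> E) X : bilin b -> linear l -> smooth X ->
  smooth (fun y => (a * b y (X y)) *: l y).
Proof.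
move=> bb ll sX; apply: smoothZ; last exact: smooth_linear ll smooth_id.
apply: smoothM; [exact: smooth_cst | exact: smooth_form].
Qed.

Lemma smooth_Bop X : smooth X -> smooth (fun y => B y (X y)).
Proof.
move=> sX; apply: smoothB.
  apply: smoothD; first exact: smooth_form_scale bilin_eta1 base_linear sX.
  exact: smooth_form_scale bilin_eta2 nu_linear sX.
exact: smooth_form_scale bilin_sigma xi2_linear sX.
Qed.

Lemma derive_Bop X x v : smooth X ->
  'D_v (fun y => B y (X y)) x = dB x v (X x) + B x ('D_v X x).
Proof.
move=> sX.
have d1 := derive_form_scale L^-1 x v bilin_eta1 base_linear sX.
have d2 := derive_form_scale (- (1 + q * rho)^-1) x v bilin_eta2 nu_linear sX.
have d3 := derive_form_scale ((1 + q * rho) / (L ^+ 2 * rho)) x v bilin_sigma xi2_linear sX.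
apply: (etrans (@derive_val _ _ _ _ _ _ _ (is_deriveB (is_deriveD d1 d2) d3))).
have zE (a a' b b' c c' : E) : (a + a') + (b + b') - (c + c') = (a + b - c) + (a' + b' - c').
  by rewrite (addrACA a) opprD (addrACA (a + b)).
exact: zE.
Qed.

Lemma smooth_Rop X : smooth X -> smooth (fun y => Rop y (X y)).
Proof.
move=> sX; apply: smoothD; first exact: smoothZr.
exact: smooth_form_scale bilin_eta3 nu_linear sX.
Qed.

Lemma derive_Rop X x v : smooth X ->
  'D_v (fun y => Rop y (X y)) x = dRop x v (X x) + Rop x ('D_v X x).
Proof.
move=> sX.
have d1 := is_deriveZ (L ^- 2) (derivableP (smooth_derivable (x:=x) (v:=v) sX)).
have d2 := derive_form_scale (3 / (L * (1 + q * rho))) x v bilin_eta3 nu_linear sX.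
apply: (etrans (@derive_val _ _ _ _ _ _ _ (is_deriveD d1 d2))).
by rewrite /dRop /Rop [RHS]addrCA.
Qed.

Lemma smooth_flow X : smooth X -> smooth (fun y => flow L (X y)).
Proof. exact: smooth_linear flow_linear. Qed.

Lemma derive_flow X x v : smooth X -> 'D_v (fun y => flow L (X y)) x = flow L ('D_v X x).
Proof. exact: derive_linear flow_linear. Qed.

Lemma smooth_bracket X Z : smooth X -> smooth Z -> smooth (lie_bracket X Z).
Proof. by move=> sX sZ; apply: smoothB; exact: smooth_derive_along. Qed.

End Derivatives.

(** * The Levi-Civita connection along T *)

Section Connection.
Context {R : realType} {m : nat}.
Local Notation E := ('M[R]_(m, 4) * 'rV[R]_4)%type.
Variables D L p q rho : R.
Hypotheses (D0 : 0 < D) (L0 : 0 < L) (q0 : 0 < q) (rho0 : 0 < rho)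
  (rhoE : rho * (1 - p ^+ 2 - q ^+ 2) = q).
Local Notation G := (Gmetric D L p q rho).
Local Notation dG := (dGmetric D L p q rho).
Local Notation nu := (nu D L p q rho).
Local Notation B := (Bop D L p q rho).
Local Notation dB := (dBop D L p q rho).
Local Notation Rop := (Rop D L p q rho).
Local Notation dRop := (dRop D L p q rho).
Local Notation M := (sphere_circle : set E).
Local Notation TM := (sphere_circle_tangent : E -> set E).
Local Notation T := (flow L : E -> E).
Implicit Types (y v w : E) (X Y Z U : E -> E).

Lemma tangentZD y a v w : TM y v -> TM y w -> TM y (a *: v + w).
Proof.
move=> [v1 [v2 v3 v4]] [w1 [w2 w3 w4]]; split; rewrite /= ?dotDr ?dotZr.
  by rewrite v1 w1 mulr0 addr0.
by rewrite v2 w2 !mxE v3 v4 w3 w4 !mulr0 !addr0.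
Qed.

Lemma tangent0 y : TM y 0.
Proof. by split; rewrite /= ?dot0r ?mxE. Qed.

Lemma tangentZ y a v : TM y v -> TM y (a *: v).
Proof. by move=> tv; rewrite -[a *: v]addr0; exact: tangentZD tv (tangent0 y). Qed.

Lemma tangentB y v w : TM y v -> TM y w -> TM y (v - w).
Proof. by move=> tv tw; rewrite addrC -scaleN1r; exact: tangentZD. Qed.

Lemma tangent_circle (z : 'rV[R]_4) : z 0 co2 = 0 -> z 0 co3 = 0 ->
  [/\ dot z (v1 D z) = 0, v1 D z 0 co2 = 0 & v1 D z 0 co3 = 0].
Proof.
move=> z2 z3; split; first by rewrite /v1 dotZr dotC dot_qi_self mulr0.
  by rewrite !mxE /= z2 z3; ring.
by rewrite !mxE /= z2 z3; ring.
Qed.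

Lemma tangent_flow y : M y -> TM y (T y).
Proof.
move=> _; split; first by rewrite /= dotZr dotC [dot _ _]dot_qi_self mulr0.
by rewrite /= dot0r !mxE.
Qed.

Lemma tangent_nu y : M y -> TM y (nu y).
Proof.
move=> [y1 [y2 y3 y4]]; have [t1 t2 t3] := tangent_circle y3 y4.
split; first by case: (eta_nu D L p q rho y1).
rewrite /=; move: (v1 D y.2) t1 t2 t3 => V t1 t2 t3.
by rewrite dotNr dotZr t1 !mxE t2 t3 !mulr0 !oppr0.
Qed.

Lemma tangent_Rop y w : M y -> TM y w -> TM y (Rop y w).
Proof. by move=> My tw; apply: tangentZD => //; apply: tangentZ; exact: tangent_nu. Qed.

(** [T w] alone leaves the tangent space of the sphere: its radial part is [- L^-1 eta1(w)], and the
    first term of [Bop] cancels it. *)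
Lemma tangent_nabla y w : M y -> TM y w -> TM y (T w + B y w).
Proof.
move=> My [w1 [w2 w3 w4]]; have [y1 [y2 y3 y4]] := My; have [t1 t2 t3] := tangent_circle y3 y4.
have [B0 _ _ _] := eta_Bop D L p q rho w y1.
split.
  have F : dot y.1 (T w).1 = - (L^-1 * eta1 y.1 w.1).
    by rewrite /= dotZr [dot _ (xi1 _)]dot_qi mulrN.
  by rewrite [LHS]dotDr B0 F addNr.
rewrite [(_ + _).2]/= -[X in _ + X]/((B y w).2) Bop_snd add0r.
move: (v1 D y.2) t1 t2 t3 => V t1 t2 t3.
by rewrite dotZr t1 !mxE t2 t3 !mulr0.
Qed.

(** [T (T y) = - L^-2 y] is radial, and [Bop] cancels it since [eta1] is [L^-1] on [T]. *)
Lemma flow_geodesic y : M y -> T (T y) + B y (T y) = 0.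
Proof.
move=> [y1 _]; have [h1 h2 _] := eta_flowr L y y.1.
have h2' : eta2 y.1 (T y).1 = 0 by rewrite h2 [eta3 _ _]dot_qk_self mulr0 oppr0.
have hs : sigma1 D y.2 (T y).2 = 0 by exact: (sigma10r D0).
rewrite /Bop h1 h2' hs y1 !mulr0 !scale0r addr0 subr0 mulr1.
congr pair; rewrite /=; last by rewrite scaler0 addr0.
by rewrite [xi1 (_ *: _)]qmulZl [qmul _ _]qmul_ii !scalerN scalerA addNr.
Qed.

Lemma Gmetric_subl y u v w : G y (u - v) w = G y u w - G y v w.
Proof. by rewrite addrC -scaleN1r (GmetricDl D0) mulN1r addrC. Qed.

Lemma Gmetric_addl y u v w : G y (u + v) w = G y u w + G y v w.
Proof. by rewrite -[u]scale1r (GmetricDl D0) mul1r scale1r. Qed.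

Lemma Gmetric_subr y u v w : G y w (u - v) = G y w u - G y w v.
Proof. by rewrite GmetricC Gmetric_subl !(GmetricC _ _ _ _ _ y w). Qed.

Lemma Gmetric_scalel y a u w : G y (a *: u) w = a * G y u w.
Proof. by rewrite -[a *: u]addr0 (GmetricDl D0) -(subrr 0) Gmetric_subl subrr addr0. Qed.

(** The difference is the only test vector needed. In the applications it is the value of a tangent
    field, so no vector has to be extended to one. *)
Lemma Gmetric_eq y v w : M y -> TM y v -> TM y w -> G y v (v - w) = G y w (v - w) -> v = w.
Proof.
move=> My tv tw e; apply/eqP; rewrite -subr_eq0; apply/negP => /negP n0.
have := Gmetric_gt0 D0 L0 q0 rho0 rhoE My (tangentB tv tw) n0.
by rewrite Gmetric_subl e subrr ltxx.
Qed.

Lemma derive_tangent_eq (W : normedModType R) (f g : E -> W) y v : smooth f -> smooth g ->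
  (forall z, M z -> f z = g z) -> M y -> TM y v -> 'D_v f y = 'D_v g y.
Proof.
move=> sf sg fg My tv; apply/eqP; rewrite -subr_eq0; apply/eqP.
rewrite -(deriveB (smooth_derivable (x:=y) (v:=v) sf) (smooth_derivable (x:=y) (v:=v) sg)).
apply: (derive_tangent_eq0 _ _ My tv); last by move=> z Mz; rewrite -[LHS]/(f z - g z) fg // subrr.
exact: smooth_differentiable (smoothB sf sg).
Qed.

Lemma tangent_field_flow : tangent_field M TM T.
Proof. by split; [exact: smooth_linear (flow_linear L) smooth_id | exact: tangent_flow]. Qed.

Lemma riemannian_Gmetric : riemannian_metric M TM G.
Proof.
split.
- by move=> y _ a v w u _ _ _; exact: (GmetricDl D0).
- by move=> y _ v w _ _; exact: GmetricC.
- by move=> y My v tv v0; exact: Gmetric_gt0.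
- by move=> X Y [sX _] [sY _]; exact: smooth_Gmetric.
Qed.

Lemma Rop_linear y : linear (Rop y).
Proof.
move=> a u w; rewrite /Rop; have -> : eta3 y.1 (a *: u + w).1 = a * eta3 y.1 u.1 + eta3 y.1 w.1.
  by rewrite /eta3 dotDr dotZr.
rewrite mulrDr mulrCA scalerDl !scalerDr !scalerA (mulrC a (L ^- 2)) (mulrC a (_ * _)).
by rewrite -!addrA; congr (_ + _); rewrite addrCA (mulrC _ a).
Qed.

(** [nu] is orthogonal to [T], so [Rop] preserves the complement of [T]. *)
Lemma Gmetric_Rop_flow y w : M y -> TM y w -> G y (Rop y w) (T y) = L ^- 2 * G y w (T y).
Proof.
move=> My [yw _]; rewrite Gmetric_addl !Gmetric_scalel.
have [y1 _] := My; have [_ _ h3] := eta_flowr L y y.1.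
rewrite (Gmetric_nu D0 L0 rhoE My); last by case: (tangent_flow My).
by rewrite h3 [eta2 _ _]dot_qj_self !mulr0 addr0.
Qed.

Lemma Rop_flow y : M y -> Rop y (T y) = L ^- 2 *: T y.
Proof.
move=> My; have [_ _ h3] := eta_flowr L y y.1.
by rewrite /Rop h3 [eta2 _ _]dot_qj_self !mulr0 scale0r addr0.
Qed.

Lemma Gmetric_flow_flow y : M y -> G y (T y) (T y) = 1.
Proof.
move=> My; have [y1 _] := My; have [h1 _ _] := eta_flowr L y y.1.
rewrite (Gmetric_flow D0 p q rho L0 _ My) h1 y1 (sigma10r D0) mulr0 addr0 mulr1 mulfV //.
by rewrite gt_eqF.
Qed.

Section LeviCivita.
Variable nabla : (E -> E) -> (E -> E) -> E -> E.
Hypothesis LC : levi_civita M TM G nabla.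

Let tfT := tangent_field_flow.

Lemma nabla_tangent_at X Y y : tangent_field M TM X -> tangent_field M TM Y -> M y ->
  TM y (nabla X Y y).
Proof. by move=> tX tY; case: (nabla_tangent (levi_civita_connection LC) tX tY) => _; apply. Qed.

(** Tangency comes from the torsion identity: on the submanifold the bracket is a difference of
    covariant derivatives. *)
Lemma tangent_field_bracket X Y : tangent_field M TM X -> tangent_field M TM Y ->
  tangent_field M TM (lie_bracket X Y).
Proof.
move=> tX tY; split; first by apply: smooth_bracket; [case: tX | case: tY].
by move=> y My; rewrite -(torsion_free LC tX tY My); apply: tangentB; exact: nabla_tangent_at.
Qed.

(* Metric compatibility, tested on [Z = nabla X Y - nabla X Y'], suffices. *)
Lemma nabla_ext X Y Y' y : tangent_field M TM X -> tangent_field M TM Y ->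
  tangent_field M TM Y' -> (forall z, M z -> Y z = Y' z) -> M y -> nabla X Y y = nabla X Y' y.
Proof.
move=> tX tY tY' YY' My.
pose Z z := nabla X Y z - nabla X Y' z.
have tn := nabla_tangent (levi_civita_connection LC) tX tY.
have tn' := nabla_tangent (levi_civita_connection LC) tX tY'.
have tZ : tangent_field M TM Z.
  split; first by apply: smoothB; [case: tn | case: tn'].
  by move=> z Mz; apply: tangentB; exact: nabla_tangent_at.
apply: (Gmetric_eq My); [exact: nabla_tangent_at | exact: nabla_tangent_at | ].
have := metric_compatible LC tX tY tZ My; have := metric_compatible LC tX tY' tZ My.
rewrite (derive_tangent_eq (smooth_Gmetric L p q rho D0 tY.1 tZ.1)
  (smooth_Gmetric L p q rho D0 tY'.1 tZ.1) _ My (tX.2 _ My)).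
  by move=> ->; rewrite YY' // => /addIr.
by move=> z Mz; rewrite YY'.
Qed.

(** With [Z] the difference of the two sides, the Koszul formula computes the product of [nabla X T]
    with [Z], and [Gmetric_Bop] gives the same value for the candidate [N]. *)
Lemma nabla_flow X y : tangent_field M TM X -> M y -> nabla X T y = T (X y) + B y (X y).
Proof.
move=> tX My.
have tn := nabla_tangent (levi_civita_connection LC) tX tfT.
pose N z := T (X z) + B z (X z).
have tN : tangent_field M TM N.
  split; first by apply: smoothD; [exact: smooth_flow tX.1 | exact: smooth_Bop D0 _ tX.1].
  by move=> z Mz; apply: tangent_nabla => //; exact: tX.2.
pose Z z := nabla X T z - N z.
have tZ : tangent_field M TM Z.
  split; first by apply: smoothB; [case: tn | case: tN].
  by move=> z Mz; apply: tangentB; [exact: nabla_tangent_at | exact: tN.2].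
apply: (Gmetric_eq My); [exact: nabla_tangent_at | exact: tN.2 | ].
rewrite -/(N y) -/(Z y) /N.
have sX := tX.1; have sZ := tZ.1; have sT := tfT.1.
(* Compatibility for the three placements of [T], [X], [Z]; after the torsion identities everything
   is linear in metric values. *)
have ha := metric_compatible LC tfT tX tZ My.
have hb := metric_compatible LC tX tfT tZ My.
have hc := metric_compatible LC tZ tfT tX My.
have t1 := torsion_free LC tX tfT My; have t2 := torsion_free LC tZ tfT My.
have t3 := torsion_free LC tX tZ My.
have dT v : 'D_v T y = T v.
  by rewrite (derive_flow L y v (@smooth_id _ _)) derive_id.
move: ha hb hc t1 t2 t3; rewrite !derive_Gmetric // /lie_bracket !dT => ha hb hc t1 t2 t3.
have key := Gmetric_Bop D0 L0 q0 rho0 rhoE My (tX.2 _ My) (tZ.2 _ My).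
have e1 : G y (nabla X T y) (Z y) - G y (nabla T X y) (Z y) =
    G y (T (X y)) (Z y) - G y ('D_(T y) X y) (Z y) by rewrite -!Gmetric_subl t1.
have e2 : G y (nabla Z T y) (X y) - G y (nabla T Z y) (X y) =
    G y (T (Z y)) (X y) - G y ('D_(T y) Z y) (X y) by rewrite -!Gmetric_subl t2.
have e3 : G y (T y) (nabla X Z y) - G y (T y) (nabla Z X y) =
    G y (T y) ('D_(X y) Z y) - G y (T y) ('D_(Z y) X y) by rewrite -!Gmetric_subr t3.
rewrite (GmetricC D L p q rho y (X y) (nabla T Z y))
  (GmetricC D L p q rho y (X y) ('D_(T y) Z y)) in ha.
rewrite Gmetric_addl; move: key e1 e2 e3 ha hb hc => {t1 t2 t3 dT}.
move: (Z y) (X y) (nabla X T y) (nabla T X y) (nabla Z T y)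
  (nabla T Z y) (nabla X Z y) (nabla Z X y).
move: ('D_(T y) X y) ('D_(T y) Z y) ('D_(X y) Z y) ('D_(Z y) X y) (G y) (dG y) (B y) (T y).
clear=> *; lra.
Qed.

(** Torsion exchanges the arguments; as [T] is linear, [D_X T = T X] cancels the first term of
    [nabla_flow]. *)
Lemma nabla_along_flow X y : tangent_field M TM X -> M y ->
  nabla T X y = 'D_(T y) X y + B y (X y).
Proof.
move=> tX My; have := torsion_free LC tX tfT My.
rewrite /lie_bracket (derive_flow L y (X y) (@smooth_id _ _)) derive_id (nabla_flow tX My).
move=> h; apply: oppr_inj; apply: (addrI (T (X y) + B y (X y))); rewrite h.
by rewrite opprD addrACA subrr addr0.
Qed.

Lemma nabla_cst0 X y : tangent_field M TM X -> M y -> nabla X (fun=> 0) y = 0.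
Proof.
move=> tX My; have t0 : tangent_field M TM (fun=> 0).
  by split; [exact: smooth_cst | move=> z _; exact: tangent0].
have := nablaDr (levi_civita_connection LC) tX t0 t0 My.
rewrite (_ : (fun z => 0 + 0) = (fun=> 0)); last by apply/funext => z; rewrite addr0.
by move=> h; apply: (addrI (nabla X (fun=> 0) y)); rewrite -h addr0.
Qed.

Lemma normal_field_tangent U : normal_field M TM G T U -> tangent_field M TM U.
Proof. by move=> [sU nU]; split=> // y /nU []. Qed.

Lemma tangent_field_mixed_curvature U : tangent_field M TM U ->
  tangent_field M TM (mixed_curvature nabla T U).
Proof.
move=> tU; have nt := nabla_tangent (levi_civita_connection LC).
have h1 := nt _ _ tU (nt _ _ tfT tfT).
have h2 := nt _ _ tfT (nt _ _ tU tfT).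
have h3 := nt _ _ (tangent_field_bracket tU tfT) tfT.
split; first by apply: smoothB; [apply: smoothB; [case: h1 | case: h2] | case: h3].
by move=> y My; apply: tangentB; [apply: tangentB; [exact: h1.2 | exact: h2.2] | exact: h3.2].
Qed.

Lemma mixed_curvatureE U y : normal_field M TM G T U -> M y ->
  mixed_curvature nabla T U y = Rop y (U y).
Proof.
move=> nU My; have tU := normal_field_tangent nU.
have nt := nabla_tangent (levi_civita_connection LC).
have t0 : tangent_field M TM (fun=> 0).
  by split; [exact: smooth_cst | move=> z _; exact: tangent0].
have sTU : smooth (fun z => T (U z)) by exact: smooth_flow tU.1.
have sBU : smooth (fun z => B z (U z)) by exact: smooth_Bop D0 _ tU.1.
have tN : tangent_field M TM (fun z => T (U z) + B z (U z)).
  by split; [exact: smoothD | move=> z Mz; apply: tangent_nabla => //; exact: tU.2].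
rewrite /mixed_curvature /curvature.
(* [nabla T T] is known to vanish only on the submanifold, so [nabla_ext] exchanges it for the zero
   field; the inner [nabla U T] is exchanged for its formula in the same way. *)
rewrite (nabla_ext tU (nt _ _ tfT tfT) t0 _ My); last first.
  by move=> z Mz; rewrite nabla_flow // flow_geodesic.
rewrite nabla_cst0 // (nabla_ext tfT (nt _ _ tU tfT) tN _ My); last first.
  by move=> z Mz; rewrite nabla_flow.
rewrite (nabla_along_flow tN My) (nabla_flow (tangent_field_bracket tU tfT) My).
have -> : 'D_(T y) (fun z => T (U z) + B z (U z)) y =
    T ('D_(T y) U y) + (dB y (T y) (U y) + B y ('D_(T y) U y)).
  rewrite -(derive_Bop L p q rho D0 y (T y) tU.1) -(derive_flow L y (T y) tU.1).
  exact: (deriveD (smooth_derivable (x:=y) (v:=T y) sTU) (smooth_derivable (x:=y) (v:=T y) sBU)).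
rewrite /lie_bracket (derive_flow L y (U y) (@smooth_id _ _)) derive_id.
have [_ [tU1 nUy]] : True /\ (TM y (U y) /\ G y (U y) (T y) = 0) by split=> //; exact: nU.2.
have nw : L * eta1 y.1 (U y).1 + p * sigma1 D y.2 (U y).2 = 0.
  by rewrite -(Gmetric_flow D0 p q rho L0 _ My) GmetricC.
rewrite -(Rop_eq D0 L0 q0 rho0 My tU1 nw).
have linB (u w : E) : B y (u - w) = B y u - B y w.
  by rewrite addrC -scaleN1r (Bop_linear D0) scaleN1r addrC.
have linB' (u w : E) : B y (u + w) = B y u + B y w.
  by have := Bop_linear D0 L p q rho y 1 u w; rewrite !scale1r.
have linT (u w : E) : T (u - w) = T u - T w.
  by rewrite addrC -scaleN1r flow_linear scaleN1r addrC.
rewrite linB linB' linT.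
move: (T ('D_(T y) U y)) (B y ('D_(T y) U y)) (dB y (T y) (U y)) (B y (T (U y)))
  (B y (B y (U y))) (T (T (U y))).
move=> a1 a2 a3 a4 a5 a6.
by congr pair => /=; apply/matrixP => i j; rewrite !mxE; ring.
Qed.

Lemma normal_nabla_normal U : normal_field M TM G T U ->
  normal_field M TM G T (normal_nabla G nabla T U).
Proof.
move=> nU; have tU := normal_field_tangent nU.
have tn := nabla_tangent (levi_civita_connection LC) tfT tU.
split.
  apply: smoothB; first by case: tn.
  by apply: smoothZ; [exact: (smooth_Gmetric L p q rho D0 tn.1 tfT.1) | case: tfT].
move=> y My; split.
  by apply: tangentB; [exact: tn.2 | apply: tangentZ; exact: tfT.2].
by rewrite Gmetric_subl Gmetric_scalel Gmetric_flow_flow // mulr1 subrr.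
Qed.

(** By [Rop_parallel], [Rop] commutes with [nabla T]. It also commutes with the projection, because
    [Rop T = L^-2 T] and the [T]-component of [Rop w] is [L^-2] times that of [w]. *)
Lemma normal_derivative_eq0 U y : normal_field M TM G T U -> M y ->
  normal_derivative_mixed_curvature G nabla T U y = 0.
Proof.
move=> nU My; have tU := normal_field_tangent nU.
have tn := nabla_tangent (levi_civita_connection LC) tfT tU.
rewrite /normal_derivative_mixed_curvature (mixed_curvatureE (normal_nabla_normal nU) My).
have tR : tangent_field M TM (fun z => Rop z (U z)).
  by split; [exact: smooth_Rop tU.1 | move=> z Mz; apply: tangent_Rop => //; exact: tU.2].
rewrite /normal_nabla.
rewrite (nabla_ext tfT (tangent_field_mixed_curvature tU) tR _ My); last first.
  by move=> z Mz; exact: mixed_curvatureE.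
have -> : nabla T (fun z => Rop z (U z)) y = Rop y (nabla T U y).
  rewrite (nabla_along_flow tR My) (nabla_along_flow tU My) (derive_Rop D L p q rho y (T y) tU.1).
  have := Rop_parallel D0 p L0 q0 rho0 My (tU.2 _ My).
  have -> : Rop y ('D_(T y) U y + B y (U y)) = Rop y ('D_(T y) U y) + Rop y (B y (U y)).
    by have := Rop_linear y 1 ('D_(T y) U y) (B y (U y)); rewrite !scale1r.
  move=> /subr0_eq <-; rewrite addrAC addrC; congr (_ + _).
rewrite Gmetric_Rop_flow //; last exact: tn.2.
have -> : Rop y (nabla T U y - G y (nabla T U y) (T y) *: T y) =
    Rop y (nabla T U y) - G y (nabla T U y) (T y) *: Rop y (T y).
  by rewrite addrC -scaleNr Rop_linear scaleNr addrC.
by rewrite Rop_flow // scalerA (mulrC (L ^- 2)) subrr.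
Qed.

End LeviCivita.
End Connection.

(** * The spectrum of R_T *)

Section Spectrum.
Context {R : realType} {m : nat}.
Local Notation E := ('M[R]_(m, 4) * 'rV[R]_4)%type.
Variables D L p q rho : R.
Hypotheses (D0 : 0 < D) (L0 : 0 < L) (q0 : 0 < q) (rho0 : 0 < rho)
  (rhoE : rho * (1 - p ^+ 2 - q ^+ 2) = q).
Local Notation G := (Gmetric D L p q rho).
Local Notation nu := (nu D L p q rho).
Local Notation Rop := (Rop D L p q rho).
Local Notation M := (sphere_circle : set E).
Local Notation TM := (sphere_circle_tangent : E -> set E).
Local Notation T := (flow L : E -> E).
Local Notation NS := (normal_space TM G T).

Let q1n0 : 1 + q * rho != 0.
Proof. by rewrite gt_eqF // addr_gt0 // mulr_gt0. Qed.
Let Ln0 : L != 0. Proof. by rewrite gt_eqF. Qed.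

Variable y : E.
Hypothesis My : M y.

Let y1 : dot y.1 y.1 = 1 := My.1.

Lemma normal_nu : NS y (nu y).
Proof.
split; first exact: tangent_nu.
rewrite (Gmetric_nu D0 L0 rhoE My); last by case: (tangent_flow L My).
by have [_ _ ->] := eta_flowr L y y.1; rewrite [eta2 _ _]dot_qj_self !mulr0.
Qed.

Lemma eta3_nu : eta3 y.1 (nu y).1 = (1 + q * rho) / L.
Proof. by case: (eta_nu D L p q rho y1). Qed.

Lemma Rop_nu : Rop y (nu y) = (4 * L ^- 2) *: nu y.
Proof. by rewrite /Rop eta3_nu -scalerDl; congr (_ *: _); field; rewrite Ln0. Qed.

Lemma nu_neq0 : nu y != 0.
Proof.
apply/eqP => h; have := eta3_nu; rewrite h [LHS]dot0r => /esym/eqP.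
by rewrite mulf_eq0 invr_eq0 (negPf q1n0) (negPf Ln0).
Qed.

Lemma Rop_eigen_small w : (Rop y w = L ^- 2 *: w) <-> eta3 y.1 w.1 = 0.
Proof.
rewrite /Rop; split=> [|->]; last by rewrite mulr0 scale0r addr0.
rewrite -[RHS]addr0 => /addrI/eqP; rewrite scaler_eq0 (negPf nu_neq0) orbF mulf_eq0.
by rewrite mulf_eq0 pnatr_eq0 invr_eq0 mulf_eq0 (negPf Ln0) (negPf q1n0) => /eqP.
Qed.

Lemma Rop_eigen_large w : (Rop y w = (4 * L ^- 2) *: w) <-> exists k, w = k *: nu y.
Proof.
split=> [|[k ->]]; last first.
  have -> : Rop y (k *: nu y) = k *: Rop y (nu y).
    rewrite /Rop [eta3 _ (_ *: _).1]dotZr scalerDr !scalerA.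
    by congr (_ *: _ + _ *: _); [rewrite mulrC | rewrite mulrCA].
  by rewrite Rop_nu !scalerA mulrC.
(* Subtracting [L^-2 w] from the eigenvalue equation leaves [3 L^-2 w] equal to a multiple of [nu];
   the witness is that multiple divided by [3 L^-2]. *)
move=> h; exists (L ^+ 2 / 3 * (3 / (L * (1 + q * rho)) * eta3 y.1 w.1)).
have : (3 * L ^- 2) *: w = (3 / (L * (1 + q * rho)) * eta3 y.1 w.1) *: nu y.
  apply: (addrI (L ^- 2 *: w)); rewrite -/(Rop y w) h -scalerDl; congr (_ *: _); ring.
move=> e; rewrite -scalerA -e scalerA -[LHS]scale1r; congr (_ *: _); field; exact: Ln0.
Qed.

(** Duality of [nu] turns the rank-one part into a positive multiple of the square of [eta3], which
    makes symmetry and positivity visible. *)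
Lemma Gmetric_Rop v w : TM y v -> TM y w ->
  G y (Rop y v) w = L ^- 2 * G y v w + 3 / (1 + q * rho) * (eta3 y.1 v.1 * eta3 y.1 w.1).
Proof.
move=> [_ _] [yw _]; rewrite Gmetric_addl // !Gmetric_scalel // (Gmetric_nu D0 L0 rhoE My) //.
by congr (_ + _); field; rewrite q1n0 Ln0.
Qed.

Lemma positive_Rop : positive_operator_at TM G T y (Rop y).
Proof.
split=> [v w [tv _] [tw _]|w [tw _] w0].
  rewrite [RHS]GmetricC !Gmetric_Rop // (GmetricC _ _ _ _ _ y w).
  by congr (_ + _ * _); rewrite mulrC.
rewrite Gmetric_Rop // ltr_pwDl //.
  by rewrite mulr_gt0 ?invr_gt0 ?exprn_gt0 //; exact: Gmetric_gt0.
by rewrite mulr_ge0 ?sqr_ge0 // divr_ge0 // ltW // addr_gt0 // mulr_gt0.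
Qed.

Lemma spectrum_Rop : (0 < m)%N ->
  spectrum_at TM G T y (Rop y) = [set L ^- 2; 4 * L ^- 2].
Proof.
move=> m0; apply/seteqP; split=> [a [w [nw ew] w0]|a /= [->|->]].
- have [/Rop_eigen_small h|h] := eqVneq (eta3 y.1 w.1) 0.
    left; apply/eqP; have := ew; rewrite h => /eqP.
    rewrite -subr_eq0 -scalerBl scaler_eq0 (negPf w0) orbF.
    by rewrite subr_eq0 eq_sym.
  (* If [eta3] is nonzero on the eigenvector, applying it to the eigenvalue equation determines the
     eigenvalue. *)
  right; apply: (mulIf h).
  have := congr1 (fun u : E => eta3 y.1 u.1) ew.
  rewrite [LHS]dotDr [X in X + _ = _]dotZr [X in _ + X = _]dotZr [RHS]dotZr.
  rewrite -!/(eta3 _ _) eta3_nu => <-.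
  by field; rewrite q1n0 Ln0.
(* [xi2] is normal to [T] and killed by [eta3], and it is present already for [m = 1]. *)
- exists (xi2 y.1, 0).
    split; last by apply/Rop_eigen_small; case: (dot_xi y.1) => _ _ _ [_ h _]; rewrite [LHS]dotC.
    split; first by split; rewrite /= ?dot0r ?mxE // dotC [LHS]dot_qj_self.
    rewrite GmetricC (Gmetric_flow D0 _ _ _ L0 _ My) (sigma10r D0) mulr0 addr0.
    by case: (dot_xi y.1) => _ _ _ [h _ _]; rewrite /= [eta1 _ _]h mulr0.
  apply/eqP => /(congr1 fst) /= h; have [_ h2 _ _] := dot_xi y.1.
  by move/eqP: h2; rewrite h dot0l y1 eq_sym oner_eq0.
- exists (nu y); last exact: nu_neq0.
  by split; [exact: normal_nu | exact: Rop_nu].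
Qed.

Lemma has_dim_large : has_dim (eigenspace_at TM G T y (Rop y) (4 * L ^- 2)) 1.
Proof.
exists <[nu y]>%VS; last by rewrite dim_vline nu_neq0.
move=> w; split=> [[_ /Rop_eigen_large h]|/vlineP [k ->]]; first exact/vlineP.
split; last by apply/Rop_eigen_large; exists k.
have [tn gn] := normal_nu; split; first exact: tangentZ.
by rewrite Gmetric_scalel // gn mulr0.
Qed.

(** Four equations for the tangent space, one for normality, one for the kernel of [eta3]. They are
    independent on a space of dimension [4m + 4], so rank-nullity yields [4m - 2]. *)
Definition constraints (w : E) : 'rV[R]_6 := \row_(i < 6)
  [:: dot y.1 w.1; dot y.2 w.2; w.2 0 co2; w.2 0 co3;
      L * eta1 y.1 w.1 + p * sigma1 D y.2 w.2; eta3 y.1 w.1]`_i.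

Lemma constraints_linear : linear constraints.
Proof.
move=> a u v; apply/rowP => i; rewrite !mxE.
case: i => [[|[|[|[|[|[|//]]]]]] hi] /=.
- by rewrite dotDr dotZr.
- by rewrite dotDr dotZr.
- by [].
- by [].
- by rewrite /eta1 dotDr dotZr (sigma1Dr D0) (sigma1Zr D0); ring.
- by rewrite /eta3 dotDr dotZr.
Qed.

Lemma constraints_surj u : exists w, constraints w = u.
Proof.
have [_ [y2 y3 y4]] := My.
pose c i := u 0 (inord i : 'I_6).
(* [w2] is chosen without a [z i] component, so [sigma] vanishes on it and the fifth equation
   reduces to [L eta1 = c 4]. *)
pose w1 := frame_comb y.1 (c 0%N) (c 4%N / L) 0 (c 5%N).
pose w2 : 'rV[R]_4 := c 1%N *: y.2 + (c 2%N *: delta_mx 0 co2 + c 3%N *: delta_mx 0 co3).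
have [e0 e1 _ e3] := eta_comb (c 0%N) (c 4%N / L) 0 (c 5%N) y1.
have hs : sigma1 D y.2 w2 = 0.
  rewrite (sigma1E D0) /w2 !dotDr !dotZr dot_qi_self !dot1E !mxE /= y3 y4; ring.
have h2 : dot y.2 w2 = c 1%N by rewrite /w2 !dotDr !dotZr y2 !dot1E !mxE /= y3 y4; ring.
exists (w1, w2); apply/rowP => i; rewrite !mxE.
have ci (j : 'I_6) : c j = u 0 j by rewrite /c inord_val.
rewrite -ci; case: i => [[|[|[|[|[|[|//]]]]]] hi] /=.
- exact: e0.
- exact: h2.
- by rewrite y3; ring.
- by rewrite y4; ring.
- by rewrite hs mulr0 addr0 e1 mulrC divfK.
- exact: e3.
Qed.

Lemma constraints_eq0 w : constraints w = 0 <-> NS y w /\ eta3 y.1 w.1 = 0.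
Proof.
have nE : G y w (T y) = L * eta1 y.1 w.1 + p * sigma1 D y.2 w.2.
  by rewrite GmetricC (Gmetric_flow D0 _ _ _ L0 _ My).
split=> [/rowP h|[[[h0 [h1 h2 h3]]]]].
  have h0 := h (@Ordinal 6 0 isT); have h1 := h (@Ordinal 6 1 isT).
  have h2 := h (@Ordinal 6 2 isT); have h3 := h (@Ordinal 6 3 isT).
  have h4 := h (@Ordinal 6 4 isT); have h5 := h (@Ordinal 6 5 isT).
  rewrite !mxE /= in h0 h1 h2 h3 h4 h5.
  by split=> //; split=> //; rewrite nE.
rewrite nE => h4 h5; apply/rowP => i; rewrite !mxE.
by case: i => [[|[|[|[|[|[|//]]]]]] hi].
Qed.

Lemma has_dim_small : has_dim (eigenspace_at TM G T y (Rop y) (L ^- 2)) (4 * m - 2).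
Proof.
pose phi : {linear E -> 'rV[R]_6} :=
  HB.pack constraints (GRing.isLinear.Build _ _ _ _ _ constraints_linear).
exists (lker (linfun phi)).
  move=> w; rewrite memv_ker lfunE /=; split=> [[nw /Rop_eigen_small h]|/eqP/constraints_eq0 [nw h]].
    by apply/eqP/constraints_eq0.
  by split=> //; apply/Rop_eigen_small.
have := limg_ker_dim (linfun phi) fullv; rewrite capfv.
have -> : (linfun phi @: fullv)%VS = fullv.
  apply/eqP; rewrite eqEsubv subvf; apply/subvP => u _.
  have [w <-] := constraints_surj u.
  by rewrite -[constraints w]/(phi w) -lfunE memv_img // memvf.
rewrite !dimvf.
have -> : dim 'rV[R]_6 = 6%N by [].
have -> : dim E = (m * 4 + 4)%N by [].
(* The equation [k + 6 = 4m + 4] already excludes [m = 0], so the subtraction of naturals is not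
   truncated. *)
move: (\dim _) => k; lia.
Qed.

Lemma Rop_at (nabla : (E -> E) -> (E -> E) -> E -> E) : (0 < m)%N -> levi_civita M TM G nabla ->
  exists f : {linear E -> E},
    [/\ mixed_curvature_at M TM G nabla T y f,
        positive_operator_at TM G T y f,
        spectrum_at TM G T y f = [set L ^- 2; 4 * L ^- 2],
        has_dim (eigenspace_at TM G T y f (4 * L ^- 2)) 1 &
        has_dim (eigenspace_at TM G T y f (L ^- 2)) (4 * m - 2)].
Proof.
move=> m0 LC.
pose f : {linear E -> E} :=
  HB.pack (Rop y) (GRing.isLinear.Build _ _ _ _ _ (Rop_linear D L p q rho y)).
exists f; split.
- split=> [U nU|w [tw nw]]; first exact: mixed_curvatureE.
  by split; [exact: tangent_Rop | rewrite [LHS]Gmetric_Rop_flow // nw mulr0].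
- exact: positive_Rop.
- exact: spectrum_Rop.
- exact: has_dim_large.
- exact: has_dim_small.
Qed.

End Spectrum.

(** * Return to the original parameters *)

Lemma gP_Gmetric (R : realType) (m : nat) (A C D p q rho : R) :
  0 < A -> 0 < C -> - (1 + q * rho)^-1 = C / A - 1 ->
  gP A C D p q = Gmetric D (2 / Num.sqrt (A * C)) p q rho
    :> ('M[R]_(m, 4) * 'rV[R]_4 -> 'M[R]_(m, 4) * 'rV[R]_4 -> 'M[R]_(m, 4) * 'rV[R]_4 -> R).
Proof.
move=> A0 C0 bE; apply/funext => y; apply/funext => v; apply/funext => w.
have An0 : A != 0 by rewrite gt_eqF.
have Cn0 : C != 0 by rewrite gt_eqF.
have s2 : Num.sqrt (A * C) ^+ 2 = A * C by rewrite sqr_sqrtr // ltW // mulr_gt0.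
have sn0 : Num.sqrt (A * C) != 0 by rewrite gt_eqF // sqrtr_gt0 mulr_gt0.
rewrite /gP /Gmetric bE.
(* Here [L^2 = 4 / (A C)] and [M^2 = 4 / A^2], so [M^2 / L^2 = C / A]. *)
have M2 : (2 / A) ^+ 2 - (2 / Num.sqrt (A * C)) ^+ 2 = (2 / Num.sqrt (A * C)) ^+ 2 * (C / A - 1).
  by rewrite !exprMn !exprVn s2; field; rewrite An0 Cn0.
(* [xi1] is orthogonal to [xi2], so only the [L^2] term acts on [u1 = L^-1 xi1]; the same holds for
   [u3]. *)
have b1 (u : 'M[R]_(m, 4)) : beta1 A C y.1 u = 2 / Num.sqrt (A * C) * eta1 y.1 u.
  rewrite /beta1 /gAC /u1 dotZl -/(eta1 _ _).
  have -> : eta2 y.1 (Num.sqrt (A * C) / 2 *: xi1 y.1) = 0.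
    by rewrite /eta2 dotZr dotC; have [_ _ _ [-> _ _]] := dot_xi y.1; rewrite mulr0.
  by rewrite mul0r mulr0 addr0; field.
have b3 (u : 'M[R]_(m, 4)) : beta3 A C y.1 u = 2 / Num.sqrt (A * C) * eta3 y.1 u.
  rewrite /beta3 /gAC /u3 dotZl -/(eta3 _ _).
  have -> : eta2 y.1 (Num.sqrt (A * C) / 2 *: xi3 y.1) = 0.
    by rewrite /eta2 dotZr; have [_ _ _ [_ -> _]] := dot_xi y.1; rewrite mulr0.
  by rewrite mul0r mulr0 addr0; field.
rewrite !b1 !b3 /gAC M2.
move: (Num.sqrt (A * C)) (sigma1 D y.2 v.2) (sigma1 D y.2 w.2) (eta1 y.1 v.1) (eta1 y.1 w.1)
  (eta3 y.1 v.1) (eta3 y.1 w.1) (eta2 y.1 v.1) (eta2 y.1 w.1) (dot v.1 w.1).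
by move=> s *; ring.
Qed.

Theorem corollary5p2 (R : realType) (m : nat) (A C p : R) :
  (1 <= m)%N -> 0 < C -> C < A -> 0 < p -> p < 1 ->
  let r := Num.sqrt (C / (A - C)) in
  let h := Num.sqrt ((1 - p ^+ 2) / (1 + r ^+ 2)) in
  let q := r * h in
  let D := Num.sqrt (A * C) / p in
  let E := ('M[R]_(m, 4) * 'rV[R]_4)%type in
  let M : set E := sphere_circle in
  let TM : E -> set E := sphere_circle_tangent in
  let g : E -> E -> E -> R := gP A C D p q in
  let T : E -> E := Tfield A C in
  riemannian_metric M TM g /\
  forall nabla : (E -> E) -> (E -> E) -> E -> E,
    levi_civita M TM g nabla ->
    (forall U, normal_field M TM g T U -> forall y, M y ->
       normal_derivative_mixed_curvature g nabla T U y = 0) /\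
    (forall y, M y -> exists f : {linear E -> E},
       [/\ mixed_curvature_at M TM g nabla T y f,
           positive_operator_at TM g T y f,
           spectrum_at TM g T y f = [set A * C / 4; A * C],
           has_dim (eigenspace_at TM g T y f (A * C)) 1 &
           has_dim (eigenspace_at TM g T y f (A * C / 4)) (4 * m - 2)]).
Proof.
move=> m0 C0 CA p0 p1 r h q D E M TM g T.
have A0 : 0 < A by exact: lt_trans CA.
have AC0 : 0 < A - C by rewrite subr_gt0.
have ACp : 0 < A * C by rewrite mulr_gt0.
have r2 : r ^+ 2 = C / (A - C) by rewrite sqr_sqrtr // ltW // divr_gt0.
have r0 : 0 < r by rewrite sqrtr_gt0 divr_gt0.
have r21 : 0 < 1 + r ^+ 2 by rewrite addr_gt0 // exprn_gt0.
have p21 : 0 < 1 - p ^+ 2 by rewrite subr_gt0 expr_lt1 // ltW.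
have h0 : 0 < h by rewrite sqrtr_gt0 divr_gt0.
have h2 : h ^+ 2 = (1 - p ^+ 2) / (1 + r ^+ 2) by rewrite sqr_sqrtr // ltW // divr_gt0.
have q0 : 0 < q by rewrite mulr_gt0.
have D0 : 0 < D by rewrite divr_gt0 // sqrtr_gt0.
pose L := 2 / Num.sqrt (A * C); pose rho := r / h.
have L0 : 0 < L by rewrite divr_gt0 // sqrtr_gt0.
have rho0 : 0 < rho by rewrite divr_gt0.
have hn0 : h != 0 by rewrite gt_eqF.
have qrho : q * rho = r ^+ 2 by rewrite /q /rho; field.
(* As [1 - p^2 = h^2 (1 + r^2)] and [q = r h], the bracket equals [h^2], and [(r / h) h^2 = r h]. *)
have rhoE : rho * (1 - p ^+ 2 - q ^+ 2) = q.
  have -> : 1 - p ^+ 2 = h ^+ 2 * (1 + r ^+ 2) by rewrite h2 divfK // gt_eqF.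
  by rewrite /rho /q; field.
(* [1 + r^2 = A / (A - C)]. *)
have bE : - (1 + q * rho)^-1 = C / A - 1.
  by rewrite qrho r2; field; rewrite !gt_eqF // subrK.
have gE : g = Gmetric D L p q rho by exact: gP_Gmetric.
have TE : T = flow L by apply/funext => y; rewrite /T /Tfield /u1 /flow /L invf_div.
have L2 : L ^- 2 = A * C / 4.
  by rewrite /L exprMn exprVn sqr_sqrtr ?ltW //; field; rewrite !gt_eqF.
have L24 : 4 * L ^- 2 = A * C by rewrite L2; field.
rewrite gE TE -L2 -L24; split; first exact: riemannian_Gmetric.
move=> nabla LC; split=> [U nU y My|y My]; first exact: normal_derivative_eq0 nU My.
exact: Rop_at.
Qed.
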